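(* Let $a,b,c\in\mathbb{N}$ be such that $(a,b,c)$ is a Rado triple, that is, $a=c$, or $b=c$, or $a+b=c$. Let $f_1,\ldots,f_s\colon\mathbb{N}\to\mathbb{S}^1$ be pretentious completely multiplicative functions. Then for every open arc $I$ of $\mathbb{S}^1$ containing $1$ there exist distinct $x,y,z\in\mathbb{N}$ such that $$ax^2+by^2=cz^2\qquad\text{and}\qquad f_j(x),\,f_j(y),\,f_j(z)\in I\quad\text{for } j=1,\ldots,s.$$
   Context: $\mathbb{N}=\{1,2,\ldots\}$; $\mathbb{S}^1$ is the unit circle in $\mathbb{C}$. A function $f\colon\mathbb{N}\to\mathbb{S}^1$ is completely multiplicative if $f(mn)=f(m)f(n)$ for all $m,n\in\mathbb{N}$. It is pretentious if there are a Dirichlet character $\chi$ and $t\in\mathbb{R}$ such that $\sum_{p\text{ prime}}\frac1p\bigl(1-\mathrm{Re}(f(p)\overline{\chi(p)}p^{-it})\bigr)<\infty$. *)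

(* Defs.v *)
From mathcomp Require Import all_boot all_order all_algebra.
From mathcomp Require Import complex.
From mathcomp Require Import all_classical all_reals all_analysis.

Set Implicit Arguments.
Unset Strict Implicit.
Unset Printing Implicit Defensive.

Import Order.TTheory GRing.Theory Num.Theory.

Local Open Scope classical_set_scope.
Local Open Scope ring_scope.
Local Open Scope complex_scope.

(* The positive integers are encoded as the n : nat with 0 < n; the value at 0
   of an arithmetic function nat -> R[i] is never constrained or used, except
   for Dirichlet characters, which are periodic functions on all of nat. *)

Definition unit_circle (R : realType) : set R[i] := [set z | `|z| = 1].

(* exp (i theta) *)
Definition expi (R : realType) (theta : R) : R[i] :=
  cos theta +i* sin theta.

(* n ^ (i t) = exp (i t log n), for n > 0 *)
Definition nat_pow_it (R : realType) (n : nat) (t : R) : R[i] :=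
  expi (t * ln n%:R).

(* When beta - alpha > 2 pi this is the whole circle. *)
Definition open_arc (R : realType) (I : set R[i]) : Prop :=
  exists alpha beta : R, alpha < beta /\
    I = [set expi theta | theta in [set theta : R | alpha < theta < beta]].

Definition completely_multiplicative (R : realType) (f : nat -> R[i]) : Prop :=
  forall m n : nat, (0 < m)%N -> (0 < n)%N -> f (m * n)%N = f m * f n.

Definition dirichlet_character (R : realType) (q : nat) (chi : nat -> R[i]) :
    Prop :=
  [/\ (0 < q)%N,
      forall n : nat, chi (n + q)%N = chi n,
      forall m n : nat, chi (m * n)%N = chi m * chi n
    & forall n : nat, chi n != 0 <-> coprime n q].

(* For f with values in the unit circle the terms of the series are
   nonnegative, so that its extended-real sum always makes sense. *)
Definition pretentious (R : realType) (f : nat -> R[i]) : Prop :=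
  exists (q : nat) (chi : nat -> R[i]) (t : R), dirichlet_character q chi /\
    (\sum_(0 <= p <oo | prime p)
       (p%:R^-1 * (1 - complex.Re (f p * (chi p)^* * nat_pow_it p (- t))))%:E
     < +oo :> \bar R)%E.

Definition rado_triple (a b c : nat) : Prop :=
  [\/ a = c, b = c | (a + b)%N = c].

(* Main.v *)
Require Import Defs.
From mathcomp Require Import all_boot all_order all_algebra.
From mathcomp Require Import cyclic complex.
From mathcomp Require Import all_classical all_reals all_analysis.
From mathcomp Require Import ring lra zify.

(** Why the theorem holds.

Scaling. It suffices to find solutions at which f_j(x) / f_j(z) and
f_j(y) / f_j(z) are close to 1: by recurrence on the torus some z ^ M with M > 0
has all f_j(z ^ M) close to 1, and one multiplies the solution by z ^ (M - 1)
[scale_solution].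

Parametrization. For a = c the equation has the solutions
x = m^2 - D n^2, y = 2 a m n, z = m^2 + D n^2 with D = a b; for c = a + b it has
x = m^2 - D n^2, y = m^2 + 2 c m n + D n^2, z = m^2 + 2 b m n + D n^2 with
D = b c. So one needs m and n at which several monic binary quadratic forms of
nonzero discriminant, and a multiple B m n of the form m n, have almost the same
value under every f_j [aligned_values].

Values of f_j. Up to a character and to n^(it), a pretentious function is
exp(i Theta) with Theta completely additive, Theta(p) = theta_p small in the sense
that the sum of theta_p^2 / p converges [pretentious_structure]. Fix w large,
Q = w!, and restrict to m = 1 + Q i and n = n0 (1 + Q j) with Q dividing n0.
The monic forms, and m n / n0, are then 1 modulo Q: the character is 1
on them and they have no prime factor up to w; n0 is chosen with
f_j(B n0) close to 1. Taking m much larger than n makes the forms close to m^2,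
and keeping m close to k0 n / n0 with k0^(i t_j) close to 1 takes
care of m n / n0.

Small and large primes. Let (i, j) range over a square box of side N = P^6. The
primes w < p <= P contribute to Theta an amount which, by the Turan-Kubilius
inequality, is concentrated around the sum of theta_p rho(p), where
rho(p) is the density of zeros of the form modulo p; the variance is bounded by
the tail of the convergent series [turan_kubilius]. A value has at most 12 prime
factors p > P, and those with theta_p not small are rare, because
p divides the form at only O(N^2 / p) points of the box, even for p of size N^2
[card_qform_large]. Averaging all these defects over the box gives a
good point [sample_point].

The means. For different forms the means are different, and they may diverge as P
grows. But rho(p) does not depend on the progressions chosen above, so the
mean over w < p <= P is A(P) - A(w) for a fixed sequence A. Since
everything above works for every w and for every P sufficiently large in terms of w,
one may take w and P from a fixed sparse sequence, and the pigeonhole principle on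
the torus gives w < P in it with A(P) - A(w) close to 0 modulo
2 pi for all forms and all j simultaneously [torus_recurrence]. *)

Set Implicit Arguments.
Unset Strict Implicit.
Unset Printing Implicit Defensive.
Import Order.TTheory GRing.Theory Num.Theory.
Import numFieldNormedType.Exports.
Local Open Scope ring_scope.

(** * Counting zeros of binary quadratic forms modulo prime powers *)

(** The triple (a, b, c) stands for the form a m^2 + b m n + c n^2. *)
Definition qform (F : int * int * int) (m n : int) : int :=
  F.1.1 * m ^+ 2 + F.1.2 * m * n + F.2 * n ^+ 2.

Definition qdisc (F : int * int * int) : int :=
  F.1.2 ^+ 2 - 4 * F.1.1 * F.2.

Lemma card_fibers_le (X Y : finType) (S : pred X) (h : X -> Y) (c : nat) :
  (forall y, #|[pred x | S x & h x == y]| <= c)%N -> (#|S| <= c * #|Y|)%N.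
Proof.
move=> hc; rewrite -sum1_card (partition_big h predT) //=.
rewrite mulnC -sum_nat_const; apply: leq_sum => y _.
by rewrite sum1_card; apply: hc.
Qed.

Lemma card_predU_le (X : finType) (A B : pred X) :
  (#|[predU A & B]| <= #|A| + #|B|)%N.
Proof. by rewrite -cardUI leq_addr. Qed.

Lemma card_le2 (X : finType) (S : pred X) :
  (forall x y z, S x -> S y -> S z -> [\/ x = y, x = z | y = z]) ->
  (#|S| <= 2)%N.
Proof.
move=> h; rewrite leqNgt; apply/card_gt2P => -[x [y [z [[Sx Sy Sz] []]]]].
by case: (h x y z Sx Sy Sz) => ->; rewrite eqxx.
Qed.

Lemma euclidz (p : nat) (x y : int) : prime p ->
  (p%:Z %| x * y)%Z = (p%:Z %| x)%Z || (p%:Z %| y)%Z.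
Proof. by move=> pp; rewrite !dvdzE abszM Euclid_dvdM. Qed.

Lemma gauss_primez (p e : nat) (x y : int) : prime p ->
  ~~ (p%:Z %| y)%Z -> ((p ^ e)%N%:Z %| x * y)%Z -> ((p ^ e)%N%:Z %| x)%Z.
Proof.
move=> pp; rewrite !dvdzE abszM /= => py; rewrite Gauss_dvdl //.
by apply: coprimeXl; rewrite prime_coprime.
Qed.

Lemma euclidz_sqr (p : nat) (x : int) : prime p ->
  (p%:Z %| x ^+ 2)%Z = (p%:Z %| x)%Z.
Proof. by move=> pp; rewrite expr2 euclidz // orbb. Qed.

Lemma dvdz_prime_exp (p e : nat) (x : int) : (0 < e)%N ->
  ((p ^ e)%N%:Z %| x)%Z -> (p%:Z %| x)%Z.
Proof.
by case: e => // e _; apply: dvdz_trans; rewrite dvdzE /= expnS dvdn_mulr.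
Qed.

(** For p prime to n and to the discriminant the derivative in m is a unit at every
root, so roots lift uniquely from p to p ^ e and there are at most two of them. *)
Lemma qform_roots (F : int * int * int) (p e : nat) (n m1 m2 m3 : int) :
  prime p -> (0 < e)%N -> ~~ (p%:Z %| qdisc F)%Z -> ~~ (p%:Z %| n)%Z ->
  ((p ^ e)%N%:Z %| qform F m1 n)%Z -> ((p ^ e)%N%:Z %| qform F m2 n)%Z ->
  ((p ^ e)%N%:Z %| qform F m3 n)%Z ->
  [\/ ((p ^ e)%N%:Z %| m1 - m2)%Z, ((p ^ e)%N%:Z %| m1 - m3)%Z
    | ((p ^ e)%N%:Z %| m2 - m3)%Z].
Proof.
case: F => [[al be] ga] pp e0 pD pn.
pose D := qdisc (al, be, ga).
(* two roots that agree modulo p agree modulo p ^ e *)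
have lift x y : (p%:Z %| x - y)%Z ->
    ((p ^ e)%N%:Z %| qform (al, be, ga) x n)%Z ->
    ((p ^ e)%N%:Z %| qform (al, be, ga) y n)%Z -> ((p ^ e)%N%:Z %| x - y)%Z.
  move=> xy hx hy.
  apply: (@gauss_primez _ _ _ (al * (x + y) + be * n)) => //; last first.
    have -> : (x - y) * (al * (x + y) + be * n)
       = qform (al, be, ga) x n - qform (al, be, ga) y n by rewrite /qform /=; ring.
    exact: rpredB.
  apply: contra pD => h; have {}hx := dvdz_prime_exp e0 hx.
  have h2 : (p%:Z %| 2 * al * x + be * n)%Z.
    have -> : 2 * al * x + be * n = al * (x + y) + be * n + al * (x - y) by ring.
    by apply: rpredD => //; apply: dvdz_mull.
  have : (p%:Z %| D * n ^+ 2)%Z.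
    have -> : D * n ^+ 2 = (2 * al * x + be * n) * (2 * al * x + be * n)
       - 4 * al * qform (al, be, ga) x n by rewrite /D /qform /qdisc /=; ring.
    by apply: rpredB; apply: dvdz_mull.
  by rewrite euclidz // euclidz_sqr // (negPf pn) orbF.
move=> h1 h2 h3.
case: (boolP (p%:Z %| m1 - m2)%Z) => [?|n12]; first by constructor 1; apply: lift.
case: (boolP (p%:Z %| m1 - m3)%Z) => [?|n13]; first by constructor 2; apply: lift.
case: (boolP (p%:Z %| m2 - m3)%Z) => [?|n23]; first by constructor 3; apply: lift.
exfalso; move/negP: pD; apply.
have quot x y : ~~ (p%:Z %| x - y)%Z ->
    ((p ^ e)%N%:Z %| qform (al, be, ga) x n)%Z ->
    ((p ^ e)%N%:Z %| qform (al, be, ga) y n)%Z ->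
    (p%:Z %| al * (x + y) + be * n)%Z.
  move=> nxy /(dvdz_prime_exp e0) hx /(dvdz_prime_exp e0) hy.
  have : (p%:Z %| (x - y) * (al * (x + y) + be * n))%Z.
    have -> : (x - y) * (al * (x + y) + be * n)
       = qform (al, be, ga) x n - qform (al, be, ga) y n by rewrite /qform /=; ring.
    exact: rpredB.
  by rewrite euclidz // (negPf nxy).
have q12 := quot _ _ n12 h1 h2; have q13 := quot _ _ n13 h1 h3.
have pal : (p%:Z %| al)%Z.
  have : (p%:Z %| al * (m2 - m3))%Z.
    have -> : al * (m2 - m3) = (al * (m1 + m2) + be * n) - (al * (m1 + m3) + be * n)
      by ring.
    exact: rpredB.
  by rewrite euclidz // (negPf n23) orbF.
have pbe : (p%:Z %| be)%Z.
  have : (p%:Z %| be * n)%Z.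
    have -> : be * n = (al * (m1 + m2) + be * n) - (m1 + m2) * al by ring.
    by apply: rpredB => //; apply: dvdz_mull.
  by rewrite euclidz // (negPf pn) orbF.
rewrite /qdisc /= expr2; apply: rpredB; first exact: dvdz_mull.
by apply: dvdz_mulr; apply: dvdz_mull.
Qed.

Lemma qform_swap (F : int * int * int) (m n : int) :
  qform F m n = qform (F.2, F.1.2, F.1.1) n m.
Proof. by rewrite /qform /=; ring. Qed.

(** Indices in one block of length p ^ e are determined by their residues; cutting a
box into such blocks turns root bounds into counts. *)
Lemma dvd_progression_eq (p e A B i0 i i' : nat) : prime p ->
  ~~ (p %| B)%N -> (i %/ p ^ e = i' %/ p ^ e)%N ->
  ((p ^ e)%N%:Z %| (A + B * (i0 + i))%N%:Z - (A + B * (i0 + i'))%N%:Z)%Z -> i = i'.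
Proof.
move=> pp pB hq hd.
have d0 : (0 < p ^ e)%N by rewrite expn_gt0 prime_gt0.
have : ((p ^ e)%N%:Z %| (i%:Z - i'%:Z) * B%:Z)%Z.
  suff -> : (i%:Z - i'%:Z) * B%:Z
     = (A + B * (i0 + i))%N%:Z - (A + B * (i0 + i'))%N%:Z by [].
  by rewrite !PoszD !PoszM !PoszD; ring.
move/(gauss_primez pp) => /(_ pB).
rewrite -eqz_mod_dvd !modz_nat => /eqP [hm].
by rewrite (divn_eq i (p ^ e)) (divn_eq i' (p ^ e)) hq hm.
Qed.

Lemma ltn_div_succ (N d i : nat) : (i < N)%N -> (i %/ d < (N %/ d).+1)%N.
Proof. by move=> h; rewrite ltnS leq_div2r // ltnW. Qed.

Section ProgressionCount.
Variables (F : int * int * int) (A1 B1 A2 B2 i0 j0 N p e : nat).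
Let m (i : nat) := (A1 + B1 * (i0 + i))%N.
Let n (j : nat) := (A2 + B2 * (j0 + j))%N.

Lemma card_qform_dvd_coprime : prime p -> (0 < e)%N ->
  ~~ (p%:Z %| qdisc F)%Z -> ~~ (p %| B1)%N ->
  (#|[pred v : 'I_N * 'I_N | ~~ (p %| n v.2)%N
       & ((p ^ e)%N%:Z %| qform F (m v.1)%:Z (n v.2)%:Z)%Z]|
    <= 2 * (N * (N %/ p ^ e).+1))%N.
Proof.
move=> pp e0 pD pB.
pose h (v : 'I_N * 'I_N) : 'I_N * 'I_(N %/ p ^ e).+1 :=
  (v.2, Ordinal (ltn_div_succ (p ^ e) (ltn_ord v.1))).
have -> : (N * (N %/ p ^ e).+1 = #|{: 'I_N * 'I_(N %/ p ^ e).+1}|)%N.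
  by rewrite card_prod !card_ord.
apply: (@card_fibers_le _ _ _ h) => y; apply: card_le2.
move=> [i1 j1] [i2 j2] [i3 j3] /=.
move=> /andP[/andP[nj1 d1] /eqP e1] /andP[/andP[_ d2] /eqP e2].
move=> /andP[/andP[_ d3] /eqP e3].
move: e2 e3; rewrite -e1 /h /= => -[ej2 ei2] [ej3 ei3]; subst j2 j3.
have := qform_roots pp e0 pD _ d1 d2 d3.
rewrite dvdzE /= => /(_ nj1).
case=> /(dvd_progression_eq pp pB) H; [constructor 1|constructor 2|constructor 3];
  congr (_, _); apply: val_inj; apply: H; congruence.
Qed.
End ProgressionCount.

Lemma card_both_dvd (A1 B1 A2 B2 i0 j0 N p : nat) : prime p ->
  ~~ (p %| B1)%N -> ~~ (p %| B2)%N ->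
  (#|[pred v : 'I_N * 'I_N | (p %| A1 + B1 * (i0 + v.1))%N
       & (p %| A2 + B2 * (j0 + v.2))%N]| <= (N %/ p).+1 ^ 2)%N.
Proof.
move=> pp pB1 pB2.
pose h (v : 'I_N * 'I_N) : 'I_(N %/ p).+1 * 'I_(N %/ p).+1 :=
  (Ordinal (ltn_div_succ p (ltn_ord v.1)), Ordinal (ltn_div_succ p (ltn_ord v.2))).
have -> : ((N %/ p).+1 ^ 2 = 1 * #|{: 'I_(N %/ p).+1 * 'I_(N %/ p).+1}|)%N.
  by rewrite card_prod !card_ord mul1n.
apply: (@card_fibers_le _ _ _ h) => c; rewrite leqNgt; apply/card_gt1P.
move=> [[i1 j1] [[i2 j2] []]]; rewrite !inE /=.
move=> /andP[/andP[a1 b1] /eqP e1] /andP[/andP[a2 b2] /eqP e2] /negP; apply.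
move: e2; rewrite -e1 /h => -[ei ej].
have dif x y : (p %| x)%N -> (p %| y)%N -> ((p ^ 1)%N%:Z %| x%:Z - y%:Z)%Z.
  by move=> hx hy; rewrite expn1; apply: rpredB.
apply/eqP; congr (_, _); apply: val_inj.
- by apply: (@dvd_progression_eq p 1 A1 B1 i0) => //; apply: dif.
- by apply: (@dvd_progression_eq p 1 A2 B2 j0) => //; apply: dif.
Qed.

(** Either p divides both variables, or the root bound applies to one variable
once the other is fixed. *)
Lemma card_qform_dvd (F : int * int * int) (A1 B1 A2 B2 i0 j0 N p e : nat) :
  prime p -> (0 < e)%N ->
  ~~ (p%:Z %| qdisc F)%Z -> ~~ (p %| B1)%N -> ~~ (p %| B2)%N ->
  (#|[pred v : 'I_N * 'I_N | ((p ^ e)%N%:Z %| qform F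
        (A1 + B1 * (i0 + v.1))%N%:Z (A2 + B2 * (j0 + v.2))%N%:Z)%Z]|
    <= 4 * (N * (N %/ p ^ e).+1) + (N %/ p).+1 ^ 2)%N.
Proof.
move=> pp e0 pD pB1 pB2.
have c1 := card_qform_dvd_coprime A1 A2 B2 i0 j0 N pp e0 pD pB1.
have pD' : ~~ (p%:Z %| qdisc (F.2, F.1.2, F.1.1))%Z.
  by move: pD; rewrite /qdisc /= mulrAC.
have c2 := card_qform_dvd_coprime A2 A1 B1 j0 i0 N pp e0 pD' pB2.
have c3 := card_both_dvd A1 A2 i0 j0 N pp pB1 pB2.
pose sw (v : 'I_N * 'I_N) := (v.2, v.1).
have swI : injective sw by move=> [a b] [c d] [-> ->].
have {}c2 : (#|[pred v : 'I_N * 'I_N | ~~ (p %| A1 + B1 * (i0 + v.1))%N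
     & ((p ^ e)%N%:Z %| qform F (A1 + B1 * (i0 + v.1))%N%:Z
          (A2 + B2 * (j0 + v.2))%N%:Z)%Z]| <= 2 * (N * (N %/ p ^ e).+1))%N.
  rewrite -(fintype.card_image swI); apply: leq_trans c2; apply: fintype.subset_leq_card.
  apply/fintype.subsetP => u /fintype.imageP[[i j] /= H ->].
  by move: H; rewrite !inE /= qform_swap.
set S1 := (X in #|X|) in c1; set S2 := (X in #|X|) in c2; set S3 := (X in #|X|) in c3.
apply: (@leq_trans (#|S1| + #|S2| + #|S3|)); last first.
  rewrite leq_add //.
  rewrite (_ : (4 * _ = 2 * (N * (N %/ p ^ e).+1) + 2 * (N * (N %/ p ^ e).+1))%N).
    by rewrite leq_add.
  by rewrite -mulnDl.
apply: (@leq_trans #|[predU [predU S1 & S2] & S3]|); last first.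
  by apply: leq_trans (card_predU_le _ _) _; rewrite leq_add2r card_predU_le.
apply: fintype.subset_leq_card; apply/fintype.subsetP => -[i j].
rewrite !inE /= => ->; rewrite !andbT.
by case: (p %| _)%N; case: (p %| _)%N.
Qed.

Lemma dvdz_small (d : nat) (x : int) : (d%:Z %| x)%Z -> `|x| < d%:Z -> x = 0.
Proof.
move=> dx xd; apply/eqP; apply: contraTT xd => x0.
by rewrite -leNgt -abszE lez_nat dvdn_leq // absz_gt0.
Qed.

Lemma leq_sqr (k : nat) : (k <= k ^ 2)%N.
Proof. by case: k => // k; rewrite expnS leq_pmulr. Qed.

(** The form x^2 - D y^2 is anisotropic over the integers when D is not a square. *)
Lemma not_square (D : int) :
  ~~ [exists e : 'I_(`|D|).+1, D == (e : nat)%:Z ^+ 2] ->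
  forall x y : int, x ^+ 2 = D * y ^+ 2 -> x = 0 /\ y = 0.
Proof.
move=> nsq x y exy.
have y0 : y = 0.
  apply/eqP; case: (boolP (y == 0)) => // yn0; exfalso.
  have : (y %| x)%Z by rewrite -(@dvdz_pexp2r _ _ 2) // exy dvdz_mull.
  case/dvdzP => c ec; move: exy; rewrite ec exprMn => /mulIf.
  rewrite expf_neq0 // => /(_ isT) eD.
  move/negP: nsq; apply; apply/existsP.
  have cD : (`|c| < (`|D|).+1)%N by rewrite ltnS -eD abszX expnS expn1; nia.
  by exists (Ordinal cD) => /=; rewrite abszE real_normK ?num_real // eD.
by split=> //; move: exy; rewrite y0 expr0n mulr0 => /eqP; rewrite sqrf_eq0 => /eqP.
Qed.

(** Solutions of L ^ 2 = D n ^ 2 modulo p lie on at most two lines through the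
origin; two solutions on one line differ by a solution. *)
Lemma sqr_congr_pair (p : nat) (D L1 L2 L3 n1 n2 n3 : int) :
  prime p -> ~~ (p%:Z %| 2 * D)%Z ->
  ~~ (p%:Z %| n1)%Z -> ~~ (p%:Z %| n2)%Z -> ~~ (p%:Z %| n3)%Z ->
  (p%:Z %| L1 ^+ 2 - D * n1 ^+ 2)%Z -> (p%:Z %| L2 ^+ 2 - D * n2 ^+ 2)%Z ->
  (p%:Z %| L3 ^+ 2 - D * n3 ^+ 2)%Z ->
  [\/ (p%:Z %| (L1 - L2) ^+ 2 - D * (n1 - n2) ^+ 2)%Z,
      (p%:Z %| (L1 - L3) ^+ 2 - D * (n1 - n3) ^+ 2)%Z
    | (p%:Z %| (L2 - L3) ^+ 2 - D * (n2 - n3) ^+ 2)%Z].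
Proof.
move=> pp; rewrite euclidz // negb_or => /andP[p2 pD] pn1 pn2 pn3 s1 s2 s3.
have line La Lb na nb : ~~ (p%:Z %| nb)%Z ->
    (p%:Z %| La ^+ 2 - D * na ^+ 2)%Z -> (p%:Z %| Lb ^+ 2 - D * nb ^+ 2)%Z ->
    (p%:Z %| (La - Lb) ^+ 2 - D * (na - nb) ^+ 2)%Z \/ (p%:Z %| La * nb + Lb * na)%Z.
  move=> pnb sa sb.
  have : (p%:Z %| (La * nb - Lb * na) * (La * nb + Lb * na))%Z.
    rewrite (_ : _ * _ = (La ^+ 2 - D * na ^+ 2) * nb ^+ 2
               - (Lb ^+ 2 - D * nb ^+ 2) * na ^+ 2); last by ring.
    by apply: rpredB; apply: dvdz_mulr.
  rewrite euclidz // => /orP[h|]; last by right.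
  left.
  have : (p%:Z %| ((La - Lb) ^+ 2 - D * (na - nb) ^+ 2) * nb ^+ 2)%Z.
    rewrite (_ : _ * _ = (La * nb - Lb * na)
         * ((La * nb - Lb * na) + 2 * Lb * (na - nb))
         + (Lb ^+ 2 - D * nb ^+ 2) * (na - nb) ^+ 2); last by ring.
    by apply: rpredD; apply: dvdz_mulr.
  by rewrite euclidz // euclidz_sqr // (negPf pnb) orbF.
case: (line L1 L2 n1 n2 pn2 s1 s2) => [?|h12]; first by constructor 1.
case: (line L1 L3 n1 n3 pn3 s1 s3) => [?|h13]; first by constructor 2.
case: (line L2 L3 n2 n3 pn3 s2 s3) => [?|h23]; first by constructor 3.
exfalso.
have : (p%:Z %| 2 * (L1 * (n2 * n3)))%Z.
  rewrite (_ : 2 * _ = (L1 * n2 + L2 * n1) * n3 + (L1 * n3 + L3 * n1) * n2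
             - (L2 * n3 + L3 * n2) * n1); last by ring.
  by apply: rpredB; [apply: rpredD|]; apply: dvdz_mulr.
rewrite !euclidz // (negPf p2) (negPf pn2) (negPf pn3) !orbF /= => pL1.
have : (p%:Z %| D * n1 ^+ 2)%Z.
  rewrite (_ : D * _ = L1 * L1 - (L1 ^+ 2 - D * n1 ^+ 2)); last by ring.
  by apply: rpredB => //; apply: dvdz_mulr.
by rewrite euclidz // euclidz_sqr // (negPf pD) (negPf pn1).
Qed.

Lemma div_eq_dist (l i i' : nat) : (0 < l)%N -> (i %/ l = i' %/ l)%N ->
  `|i%:Z - i'%:Z| < l%:Z.
Proof.
move=> l0 h.
have := divn_eq i l; have := divn_eq i' l; rewrite h.
have := ltn_pmod i l0; have := ltn_pmod i' l0.
move: (i' %/ l * l)%N (i %% l)%N (i' %% l)%N => a b c; lia.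
Qed.

Lemma sqr_form_bound (a b D l x y : int) (B1 B2 : nat) :
  `|x| <= l -> `|y| <= l ->
  `|(2 * a * (B1%:Z * x) + b * (B2%:Z * y)) ^+ 2 - D * (B2%:Z * y) ^+ 2|
  <= ((2 * `|a| * B1%:Z + `|b| * B2%:Z) ^+ 2 + `|D| * B2%:Z ^+ 2) * l ^+ 2.
Proof.
move=> hx hy.
have l0 : 0 <= l by apply: le_trans hx.
apply: (le_trans (ler_normB _ _)); rewrite [leRHS]mulrDl; apply: lerD.
  rewrite normrX -exprMn lerXn2r ?nnegrE //.
    by rewrite mulr_ge0 // addr_ge0 ?mulr_ge0.
  apply: (le_trans (ler_normD _ _)); rewrite [leRHS]mulrDl !normrM; apply: lerD.
    rewrite (_ : `|2| = 2 :> int) // (_ : `|B1%:Z| = B1%:Z) // -!mulrA.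
    by do ![apply: ler_wpM2l => //].
  rewrite (_ : `|B2%:Z| = B2%:Z) // -!mulrA.
  by do ![apply: ler_wpM2l => //].
rewrite normrM normrX normrM (_ : `|B2%:Z| = B2%:Z) // exprMn mulrA.
apply: ler_wpM2l; first by rewrite mulr_ge0 // sqr_ge0.
by rewrite lerXn2r ?nnegrE.
Qed.

(** The pair A', B' allows one constant to serve for both coordinates. *)
Lemma progression_bound (A B A' B' C0 N i0 i : nat) : (0 < N)%N ->
  (i0 <= C0 * N)%N -> (i < N)%N ->
  (A + B * (i0 + i) <= (A + A' + (B + B') * C0.+1) * N)%N.
Proof.
move=> N0 hi0 iN; rewrite mulnDl; apply: leq_add.
  by rewrite mulnDl (leq_trans _ (leq_addr _ _)) // leq_pmulr.
rewrite -mulnA leq_mul ?leq_addr // mulSn addnC leq_add //.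
exact: ltnW.
Qed.

Lemma mid_prime_bound (p N y z K : nat) : (z <= 4 * (N * y) + y ^ 2)%N ->
  (p * y <= K * N)%N -> (y <= 2 * N)%N -> (p * z <= 6 * K * N ^ 2)%N.
Proof.
move=> hz hp hy; apply: (@leq_trans (p * (6 * (N * y)))).
  rewrite leq_mul2l; apply/orP; right; apply: (leq_trans hz).
  rewrite (_ : 6 = 4 + 2)%N // mulnDl leq_add2l expnS expn1 mulnA.
  by rewrite leq_mul2r hy orbT.
rewrite -[(6 * K)%N]mulnC -!mulnA mulnCA (mulnCA p) (mulnC K) -mulnA.
rewrite leq_mul2l /= expnS expn1 -mulnA leq_mul2l; apply/orP; right.
by rewrite (mulnC N K).
Qed.

Lemma qform_bound (F : int * int * int) (m n X : int) :
  `|m| <= X -> `|n| <= X ->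
  `|qform F m n| <= (`|F.1.1| + `|F.1.2| + `|F.2|) * X ^+ 2.
Proof.
move=> hm hn; have X0 : 0 <= X by apply: le_trans hm.
rewrite !mulrDl /qform; apply: (le_trans (ler_normD _ _)); apply: lerD.
  apply: (le_trans (ler_normD _ _)); apply: lerD.
    rewrite normrM normrX.
    by apply: ler_wpM2l => //; rewrite lerXn2r ?nnegrE.
  by rewrite !normrM -mulrA expr2; apply: ler_wpM2l => //; apply: ler_pM.
by rewrite normrM normrX; apply: ler_wpM2l => //; rewrite lerXn2r ?nnegrE.
Qed.

Lemma linform_bound (a b m n X : int) : `|m| <= X -> `|n| <= X ->
  `|a * m + b * n| <= (`|a| + `|b|) * X.
Proof.
move=> hm hn; apply: (le_trans (ler_normD _ _)); rewrite mulrDl !normrM.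
by apply: lerD; apply: ler_wpM2l.
Qed.

(** The form splits into two linear factors, up to a constant, and p divides
one of them, which is nonzero. *)
Lemma qform_square_disc_dvd (F : int * int * int) (e : int) (p : nat) (m n X : int) :
  qdisc F = e ^+ 2 -> prime p -> (p%:Z %| qform F m n)%Z -> qform F m n != 0 ->
  `|m| <= X -> `|n| <= X ->
  p%:Z <= (2 * `|F.1.1| + `|F.1.2| + `|F.2| + `|e| + 1) * X.
Proof.
move=> De pp pF F0 hm hn.
have X0 : 0 <= X by apply: le_trans hm.
rewrite leNgt; apply/negP => bp; move/negP: F0; apply; apply/eqP.
have kill (x y : int) : `|x * m + y * n| <= (`|x| + `|y|) * X ->
   `|x| + `|y| <= 2 * `|F.1.1| + `|F.1.2| + `|F.2| + `|e| + 1 ->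
   (p%:Z %| x * m + y * n)%Z -> x * m + y * n = 0.
  move=> h1 h2 /dvdz_small; apply; apply: le_lt_trans bp; apply: (le_trans h1).
  exact: ler_wpM2r.
have g1 : 0 <= `|F.1.1| by []. have g2 : 0 <= `|F.1.2| by [].
have g3 : 0 <= `|F.2| by []. have g4 : 0 <= `|e| by [].
have [a0|a0] := eqVneq F.1.1 0.
  have FE : qform F m n = (0 * m + 1 * n) * (F.1.2 * m + F.2 * n).
    by rewrite /qform a0; ring.
  move: pF; rewrite FE euclidz // => /orP[] hd.
    rewrite (kill 0 1 (linform_bound 0 1 hm hn) _ hd) ?mul0r // normr0 normr1.
    move: g1 g2 g3 g4; lra.
  rewrite (kill _ _ (linform_bound _ _ hm hn) _ hd) ?mulr0 //.
  move: g1 g2 g3 g4; lra.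
have FE : 4 * F.1.1 * qform F m n = (2 * F.1.1 * m + (F.1.2 - e) * n)
    * (2 * F.1.1 * m + (F.1.2 + e) * n).
  transitivity ((2 * F.1.1 * m + F.1.2 * n) ^+ 2 - e ^+ 2 * n ^+ 2).
    by rewrite -De /qdisc /qform; ring.
  by ring.
have a40 : 4 * F.1.1 != 0 by rewrite mulf_neq0.
suff /eqP : 4 * F.1.1 * qform F m n = 0 by rewrite mulf_eq0 (negPf a40) => /eqP.
have : (p%:Z %| 4 * F.1.1 * qform F m n)%Z by apply: dvdz_mull.
have n2 : `|2 * F.1.1| = 2 * `|F.1.1| by rewrite normrM.
rewrite FE euclidz // => /orP[] hd.
  rewrite (kill _ _ (linform_bound _ _ hm hn) _ hd) ?mul0r // n2.
  have := ler_normB F.1.2 e; move: g1 g2 g3 g4; lra.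
rewrite (kill _ _ (linform_bound _ _ hm hn) _ hd) ?mulr0 // n2.
have := ler_normD F.1.2 e; move: g1 g2 g3 g4; lra.
Qed.

(** The side l of the cells: as large as possible subject to the smallness of the
form on vectors shorter than l, hence of order the square root of p. *)
Lemma max_cell (K p : nat) : (0 < K)%N -> (K < p)%N ->
  exists l : nat, [/\ (0 < l)%N, (K * l ^ 2 < p)%N & (p <= 4 * K * l ^ 2)%N].
Proof.
move=> K0 Kp.
have exP : exists l, (K * l ^ 2 < p)%N by exists 1%N; rewrite exp1n muln1.
have bP l : (K * l ^ 2 < p)%N -> (l <= p)%N.
  move=> /ltnW; apply: leq_trans; apply: (leq_trans (leq_sqr l)).
  by rewrite leq_pmull.
case: (ex_maxnP exP bP) => l Pl lmax; exists l.
have l0 : (0 < l)%N by apply: lmax; rewrite exp1n muln1.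
split=> //; rewrite leqNgt; apply/negP => h.
have /lmax : (K * l.+1 ^ 2 < p)%N; last by rewrite ltnn.
have e4 : (4 * K * l ^ 2 = K * (2 * l) ^ 2)%N.
  by rewrite expnMn mulnA (mulnC K).
apply: leq_ltn_trans h; rewrite e4 leq_mul2l; apply/orP; right.
by rewrite leq_exp2r // mul2n -addnn -addn1 leq_add2l.
Qed.

Lemma cell_count_bound (p K l y N C z : nat) : (p <= 4 * K * l ^ 2)%N ->
  (l * y <= C * N)%N -> (z <= 2 * y ^ 2)%N -> (p * z <= 8 * K * C ^ 2 * N ^ 2)%N.
Proof.
move=> hp hl hz; apply: (@leq_trans (4 * K * l ^ 2 * (2 * y ^ 2))).
  exact: leq_mul.
rewrite (_ : 4 * K * l ^ 2 * (2 * y ^ 2) = 8 * K * (l * y) ^ 2)%N.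
  by rewrite -[(8 * K * C ^ 2 * _)%N]mulnA -expnMn leq_mul2l leq_exp2r // hl orbT.
by rewrite expnMn; lia.
Qed.

Section LargePrimes.
Variables (F : int * int * int) (A1 B1 A2 B2 : nat).
Hypotheses (D0 : qdisc F != 0) (B1_gt0 : (0 < B1)%N) (B2_gt0 : (0 < B2)%N).
Let m (i : nat) := (A1 + B1 * i)%N.
Let n (j : nat) := (A2 + B2 * j)%N.

(** Points in one small cell on which the form vanishes modulo p: two of any
three of them differ by a short vector on which L ^ 2 - D n ^ 2 vanishes modulo
p, hence vanishes, which is impossible when D is not a square. *)
Lemma card_qform_cells (i0 j0 N l p : nat) :
  ~~ [exists e : 'I_(`|qdisc F|).+1, qdisc F == (e : nat)%:Z ^+ 2] ->
  prime p -> ~~ (p%:Z %| 2 * qdisc F)%Z ->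
  (forall j, (j < N)%N -> ~~ (p %| n (j0 + j))%N) -> (0 < l)%N ->
  (((2 * `|F.1.1| * B1%:Z + `|F.1.2| * B2%:Z) ^+ 2 + `|qdisc F| * B2%:Z ^+ 2)
     * l%:Z ^+ 2 < p%:Z) ->
  (#|[pred v : 'I_N * 'I_N |
       (p%:Z %| qform F (m (i0 + v.1))%:Z (n (j0 + v.2))%:Z)%Z]|
   <= 2 * (N %/ l).+1 ^ 2)%N.
Proof.
move=> nsq pp pD pn l0 lp.
have a0 : F.1.1 != 0.
  apply: contra nsq => /eqP a0; apply/existsP.
  have bD : (`|F.1.2| < (`|qdisc F|).+1)%N.
    by rewrite /qdisc a0 mulr0 mul0r subr0 abszX ltnS leq_sqr.
  exists (Ordinal bD) => /=.
  by rewrite abszE real_normK ?num_real // /qdisc a0 mulr0 mul0r subr0.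
pose h (v : 'I_N * 'I_N) : 'I_(N %/ l).+1 * 'I_(N %/ l).+1 :=
  (Ordinal (ltn_div_succ l (ltn_ord v.1)), Ordinal (ltn_div_succ l (ltn_ord v.2))).
have -> : ((N %/ l).+1 ^ 2 = #|{: 'I_(N %/ l).+1 * 'I_(N %/ l).+1}|)%N.
  by rewrite card_prod !card_ord.
apply: (@card_fibers_le _ _ _ h) => y; apply: card_le2.
pose L x y := 2 * F.1.1 * x + F.1.2 * y.
have sol (i j : nat) : (p%:Z %| qform F (m (i0 + i))%:Z (n (j0 + j))%:Z)%Z ->
    (p%:Z %| L (m (i0 + i))%:Z (n (j0 + j))%:Z ^+ 2
       - qdisc F * (n (j0 + j))%:Z ^+ 2)%Z.
  move=> hv; rewrite (_ : _ - _ = 4 * F.1.1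
     * qform F (m (i0 + i))%:Z (n (j0 + j))%:Z); last first.
    by rewrite /L /qdisc /qform; ring.
  exact: dvdz_mull.
have same (v v' : 'I_N * 'I_N) : h v = h v' ->
   (p%:Z %| (L (m (i0 + v.1))%:Z (n (j0 + v.2))%:Z
             - L (m (i0 + v'.1))%:Z (n (j0 + v'.2))%:Z) ^+ 2
       - qdisc F * ((n (j0 + v.2))%:Z - (n (j0 + v'.2))%:Z) ^+ 2)%Z -> v = v'.
  case: v v' => [i j] [i' j'] [/= hi hj].
  set x := i%:Z - i'%:Z; set z := j%:Z - j'%:Z.
  have -> : (n (j0 + j))%:Z - (n (j0 + j'))%:Z = B2%:Z * z.
    by rewrite /n !PoszD !PoszM !PoszD /z; ring.
  have -> : L (m (i0 + i))%:Z (n (j0 + j))%:Z - L (m (i0 + i'))%:Z (n (j0 + j'))%:Z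
      = 2 * F.1.1 * (B1%:Z * x) + F.1.2 * (B2%:Z * z).
    by rewrite /L /m /n !PoszD !PoszM !PoszD /z /x; ring.
  move=> hd.
  have := @sqr_form_bound F.1.1 F.1.2 (qdisc F) l%:Z x z B1 B2
     (ltW (div_eq_dist l0 hi)) (ltW (div_eq_dist l0 hj)).
  move=> /le_lt_trans /(_ lp) /(dvdz_small hd) /eqP.
  rewrite subr_eq0 => /eqP /(not_square nsq) [hL /eqP].
  rewrite mulf_eq0 => /orP[|/eqP z0]; first by move: B2_gt0; case: (B2).
  move: hL; rewrite z0 !mulr0 addr0 => /eqP.
  rewrite !mulf_eq0 (negPf a0) /= => /orP[|/eqP x0].
    by move: B1_gt0; case: (B1).
  congr (_, _); apply: val_inj => /=.
    by move/eqP: x0; rewrite subr_eq0 => /eqP[].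
  by move/eqP: z0; rewrite subr_eq0 => /eqP[].
move=> v1 v2 v3 /= /andP[s1 /eqP e1] /andP[s2 /eqP e2] /andP[s3 /eqP e3].
have pnz (j : 'I_N) : ~~ (p%:Z %| (n (j0 + j))%:Z)%Z by rewrite dvdzE /=; apply: pn.
have := sqr_congr_pair pp pD (pnz v1.2) (pnz v2.2) (pnz v3.2)
   (sol _ _ s1) (sol _ _ s2) (sol _ _ s3).
by case=> /same H; [constructor 1|constructor 2|constructor 3]; apply: H; congruence.
Qed.

(** The bound O(N^2 / p) for all large primes, including those between N and N^2
for which congruence counting gives nothing. A prime exceeding a multiple of N
can divide a value of a form of square discriminant only if that value is zero,
while for a non-square discriminant the box is cut into cells of area about p,
each containing at most two points. *)
Lemma card_qform_large (C0 : nat) : exists C : nat, forall N i0 j0 p : nat,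
  (0 < N)%N -> (i0 <= C0 * N)%N -> (j0 <= C0 * N)%N ->
  prime p -> (C < p)%N ->
  (forall i j, (i < N)%N -> (j < N)%N -> (0 < n (j0 + j))%N /\
     qform F (m (i0 + i))%:Z (n (j0 + j))%:Z != 0) ->
  (p * #|[pred v : 'I_N * 'I_N |
       (p%:Z %| qform F (m (i0 + v.1))%:Z (n (j0 + v.2))%:Z)%Z]| <= C * N ^ 2)%N.
Proof.
pose H := (A1 + A2 + (B1 + B2) * C0.+1)%N.
pose a := `|F.1.1|%N; pose b := `|F.1.2|%N; pose c := `|F.2|%N.
pose d := `|qdisc F|%N.
pose K1 := ((2 * a + b + c + d).+1 * H).+1%N.
pose K2 := ((2 * a * B1 + b * B2) ^ 2 + d * B2 ^ 2)%N.
pose C1 := ((a + b + c) * H ^ 2).+1%N.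
pose C := (6 * K1.+1 + 8 * K2 * C1.+1 ^ 2 + 2 * d + B1 + B2 + 2 + K2)%N.
exists C.
move=> N i0 j0 p N0 hi0 hj0 pp Cp nz.
have small (x : nat) : (0 < x)%N -> (x <= C)%N -> ~~ (p %| x)%N.
  by move=> x0 xC; rewrite gtnNdvd // (leq_ltn_trans xC).
have CB1 : (B1 <= C)%N by do 3![apply: leq_trans (leq_addr _ _)]; apply: leq_addl.
have CB2 : (B2 <= C)%N by do 2![apply: leq_trans (leq_addr _ _)]; apply: leq_addl.
have CD : (2 * d <= C)%N by do 4![apply: leq_trans (leq_addr _ _)]; apply: leq_addl.
have pD2 : ~~ (p%:Z %| 2 * qdisc F)%Z.
  by rewrite dvdzE abszM; apply: small => //; rewrite muln_gt0 /= absz_gt0.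
have mH i : (i < N)%N -> (m (i0 + i) <= H * N)%N.
  exact: progression_bound.
have nH j : (j < N)%N -> (n (j0 + j) <= H * N)%N.
  by move=> jN; rewrite /H (addnC A1) (addnC B1); apply: progression_bound.
set S := (X in #|X|).
have [pK|Kp] := leqP p (K1 * N).
  have := card_qform_dvd (F := F) (e := 1) A1 A2 i0 j0 N pp isT _
     (small _ B1_gt0 CB1) (small _ B2_gt0 CB2).
  rewrite expn1 -/S => /(_ _) cS.
  have {}cS : (#|S| <= 4 * (N * (N %/ p).+1) + (N %/ p).+1 ^ 2)%N.
    apply: cS; move: pD2; rewrite euclidz // negb_or => /andP[] //.
  apply: (@leq_trans (6 * K1.+1 * N ^ 2)); last first.
    by rewrite leq_mul2r /C; apply/orP; right; rewrite -!addnA leq_addr.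
  have y1 : (p * (N %/ p).+1 <= K1.+1 * N)%N.
    by rewrite mulnS addnC mulSn leq_add // mulnC leq_trunc_div.
  have y2 : ((N %/ p).+1 <= 2 * N)%N.
    by rewrite mul2n -addnn -addn1 leq_add // leq_div.
  exact: mid_prime_bound cS y1 y2.
have S0 : (forall i j, (i < N)%N -> (j < N)%N ->
    ~~ (p%:Z %| qform F (m (i0 + i))%:Z (n (j0 + j))%:Z)%Z) ->
    (p * #|S| <= C * N ^ 2)%N.
  move=> h; rewrite (_ : #|S| = 0%N) ?muln0 //.
  by apply: eq_card0 => -[i j]; rewrite !inE /=; apply/negbTE/h.
have mZ i : (i < N)%N -> `|(m (i0 + i))%:Z| <= (H * N)%N%:Z.
  by move=> iN; rewrite -abszE lez_nat; apply: mH.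
have nZ i : (i < N)%N -> `|(n (j0 + i))%:Z| <= (H * N)%N%:Z.
  by move=> iN; rewrite -abszE lez_nat; apply: nH.
case: (boolP [exists e : 'I_(`|qdisc F|).+1, qdisc F == (e : nat)%:Z ^+ 2]).
  move=> /existsP[e /eqP De]; apply: S0 => i j iN jN; apply/negP => pF.
  have [n0 F0] := nz i j iN jN.
  have ed : (e <= d)%N by rewrite -ltnS; apply: ltn_ord.
  have := qform_square_disc_dvd De pp pF F0 (mZ _ iN) (nZ _ jN).
  apply/negP; rewrite -ltNge; apply: le_lt_trans (_ : (K1 * N)%N%:Z < _) => //.
  rewrite (_ : _ * _ = ((2 * a + b + c + e).+1 * (H * N))%N%:Z); last first.
    by move: (H * N)%N => X; rewrite [RHS]PoszM -[(_ + _).+1%N]addn1 4!PoszD PoszM.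
  rewrite lez_nat mulnA leq_mul2r; apply/orP; right; apply: leqW.
  by rewrite leq_mul2r ltnS leq_add2l ed orbT.
move=> nsq.
have [pC1|] := leqP p (C1 * N ^ 2); last first.
  move=> C1p; apply: S0 => i j iN jN; apply/negP => /dvdz_small.
  have [n0 F0] := nz i j iN jN.
  move=> h; move/eqP: F0; apply; apply: h.
  apply: (le_lt_trans (qform_bound _ (mZ _ iN) (nZ _ jN))).
  apply: le_lt_trans (_ : (C1 * N ^ 2)%N%:Z < _) => //.
  rewrite (_ : _ * _ = ((a + b + c) * (H * N) ^ 2)%N%:Z); last first.
    move: (H * N)%N => X.
    by rewrite [RHS]PoszM !PoszD -[in RHS]mulnn expr2 PoszM.
  by rewrite lez_nat expnMn mulnA leq_mul2r leqnSn orbT.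
have K20 : (0 < K2)%N.
  rewrite /K2 addn_gt0; apply/orP; right.
  by rewrite muln_gt0 absz_gt0 D0 expn_gt0 B2_gt0.
have K2p : (K2 < p)%N by apply: leq_ltn_trans Cp; apply: leq_addl.
have [l [l0 lp pl]] := max_cell K20 K2p.
have lN : (l <= C1 * N)%N.
  rewrite -(@leq_exp2r _ _ 2) //; apply: (leq_trans (leq_pmull _ K20)).
  apply: (leq_trans (ltnW lp)); apply: (leq_trans pC1).
  by rewrite expnMn leq_mul2r leq_sqr orbT.
have cS := @card_qform_cells i0 j0 N l p nsq pp pD2 _ l0 _.
apply: (@leq_trans (8 * K2 * C1.+1 ^ 2 * N ^ 2)).
  apply: (@cell_count_bound _ _ l (N %/ l).+1) => //.
    by rewrite mulnS mulSn addnC leq_add // mulnC leq_trunc_div.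
  apply: cS.
    move=> j jN; have [n0 _] := nz 0%N j N0 jN.
    rewrite gtnNdvd // (leq_ltn_trans (nH _ jN)) // (leq_ltn_trans _ Kp) //.
    by rewrite leq_mul2r; apply/orP; right; apply: leqW; apply: leq_pmull.
  rewrite (_ : _ * _ = (K2 * l ^ 2)%N%:Z); first by rewrite ltz_nat.
  by rewrite /K2 -!mulnn !expr2 !PoszM !PoszD !PoszM.
rewrite leq_mul2r; apply/orP; right.
by do 5![apply: leq_trans (leq_addr _ _)]; apply: leq_addl.
Qed.
End LargePrimes.

(** * Periodic functions on boxes and the Turan-Kubilius inequality *)

Section PeriodicSums.
Variable R : realFieldType.
Implicit Types (g : nat -> R) (d : nat).

Definition has_period d (g : nat -> R) := forall i, g (i + d)%N = g i.

Lemma has_periodM d g k : has_period d g -> has_period (k * d) g.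
Proof.
by move=> gd; elim: k => [i|k IH i]; rewrite ?mul0n ?addn0 // mulSn addnA IH gd.
Qed.

Lemma has_period_modn d g i : has_period d g -> g (i %% d)%N = g i.
Proof.
by move=> gd; rewrite {2}(divn_eq i d) addnC (has_periodM _ gd).
Qed.

Lemma sum_shift d g a : has_period d g ->
  \sum_(i < d) g (a + i)%N = \sum_(i < d) g i.
Proof.
move=> gd; elim: a => [|a IH]; first by apply: eq_bigr => i _; rewrite add0n.
rewrite -IH; case: d gd {IH} => [|d] gd; first by rewrite !big_ord0.
rewrite big_ord_recr [RHS]big_ord_recl /= addrC; congr (_ + _).
  by rewrite addSnnS gd addn0.
by apply: eq_bigr => i _; rewrite /bump /= add1n addSnnS.
Qed.

Lemma sum_periods d g a k : has_period d g ->
  \sum_(i < k * d) g (a + i)%N = k%:R * \sum_(i < d) g i.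
Proof.
move=> gd; elim: k a => [|k IH] a; first by rewrite mul0r mul0n big_ord0.
rewrite mulSn big_split_ord /= sum_shift //.
under [X in _ + X]eq_bigr => i _ do rewrite addnA.
by rewrite IH -addn1 natrD mulrDl mul1r addrC.
Qed.

Lemma sum_period_error d g a N (M : R) : (0 < d)%N -> has_period d g ->
  (forall i, `|g i| <= M) ->
  `|\sum_(i < N) g (a + i)%N - (N %/ d)%:R * \sum_(i < d) g i| <= d%:R * M.
Proof.
move=> d0 gd gM; have M0 : 0 <= M by apply: le_trans (gM 0%N).
have -> : \sum_(i < N) g (a + i)%N
    = \sum_(i < N %/ d * d + N %% d) g (a + i)%N by rewrite -divn_eq.
rewrite big_split_ord /= sum_periods // addrAC subrr add0r.
apply: (le_trans (ler_norm_sum _ _ _)).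
apply: (@le_trans _ _ (\sum_(i < N %% d) M)); first exact: ler_sum.
rewrite sumr_const card_ord -[leLHS]mulr_natl ler_wpM2r // ler_nat.
by rewrite ltnW // ltn_pmod.
Qed.

(** An affine map with unit slope permutes the residues. *)
Lemma sum_affine d g a c : (0 < d)%N -> coprime c d -> has_period d g ->
  \sum_(i < d) g (a + c * i)%N = \sum_(i < d) g i.
Proof.
case: d => // d _ cd gd.
pose h (i : 'I_d.+1) : 'I_d.+1 := inord ((a + c * i) %% d.+1).
have hE i : h i = ((a + c * i) %% d.+1)%N :> nat.
  by rewrite /h inordK // ltn_pmod.
have hI : injective h.
  move=> i j /(congr1 (@nat_of_ord _)); rewrite !hE => /eqP.
  rewrite eqn_modDl => e; apply: val_inj => /=.
  wlog ij : i j e / (j <= i)%N.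
    by move=> H; case: (leqP j i) => [|/ltnW] ij; [|symmetry];
       apply: H => //; rewrite eq_sym.
  move: e; rewrite eqn_mod_dvd ?leq_mul2l ?ij ?orbT // -mulnBr Gauss_dvdr; last first.
    by rewrite coprime_sym.
  have := ltn_ord i; case: (posnP (i - j)) => [/eqP|ij0 id0].
    by rewrite subn_eq0 => ji _ _; apply/eqP; rewrite eqn_leq ji.
  by move=> /(dvdn_leq ij0); rewrite leqNgt ltnS (leq_trans (leq_subr _ _)).
rewrite [RHS](reindex h); last by apply: onW_bij; apply: injF_bij.
by apply: eq_bigr => i _; rewrite hE has_period_modn.
Qed.

Lemma sum_mul_blocks p q g :
  \sum_(i < p * q) g i = \sum_(a < p) \sum_(b < q) g (a + p * b)%N.
Proof.
elim: q => [|q IH].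
  by rewrite muln0 big_ord0 big1 // => a _; rewrite big_ord0.
rewrite mulnS addnC big_split_ord /= IH -big_split /=.
by apply: eq_bigr => a _; rewrite big_ord_recr /= addnC.
Qed.

(** Chinese remaindering, as a statement on sums over complete periods. *)
Lemma sum_coprime_periods p q g h : (0 < q)%N -> coprime p q ->
  has_period p g -> has_period q h ->
  \sum_(i < p * q) g i * h i = (\sum_(i < p) g i) * (\sum_(i < q) h i).
Proof.
move=> q0 pq gp hq; rewrite (sum_mul_blocks p q (fun i => g i * h i)) mulr_suml.
apply: eq_bigr => a _; rewrite -(sum_affine a q0 pq hq) mulr_sumr.
by apply: eq_bigr => b _; rewrite mulnC (has_periodM _ gp).
Qed.

Definition box N i0 j0 (phi : nat -> nat -> R) : R :=
  \sum_(i < N) \sum_(j < N) phi (i0 + i)%N (j0 + j)%N.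

Definition has_period2 d (phi : nat -> nat -> R) :=
  (forall j, has_period d (phi^~ j)) /\ (forall i, has_period d (phi i)).

(** Complete periods cancel; what remains are at most 2 N d points near two sides of
the box. *)
Lemma box_period_sum0 d N i0 j0 phi : (0 < d)%N -> has_period2 d phi ->
  (forall i j, `|phi i j| <= 1) -> box d 0 0 phi = 0 ->
  `|box N i0 j0 phi| <= 2 * d%:R * N%:R.
Proof.
move=> d0 [phi1 phi2] phi_le1 phi0.
pose g (i : nat) : R := \sum_(j < d) phi i j.
have gd : has_period d g by move=> i; apply: eq_bigr => j _; apply: phi1.
have gM i : `|g i| <= d%:R.
  apply: (le_trans (ler_norm_sum _ _ _)).
  apply: (@le_trans _ _ (\sum_(j < d) (1 : R))); first exact: ler_sum.
  by rewrite sumr_const card_ord.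
have sg : \sum_(i < d) g i = 0.
  transitivity (box d 0 0 phi) => //.
have -> : box N i0 j0 phi = \sum_(i < N) (\sum_(j < N) phi (i0 + i)%N (j0 + j)%N
    - (N %/ d)%:R * g (i0 + i)%N) + (N %/ d)%:R * \sum_(i < N) g (i0 + i)%N.
  by rewrite /box [X in _ + X]mulr_sumr -big_split /=; apply: eq_bigr => i _; rewrite subrK.
rewrite (_ : 2 * d%:R * N%:R = N%:R * d%:R + d%:R * N%:R :> R); last by ring.
apply: (le_trans (ler_normD _ _)); apply: lerD.
  apply: (le_trans (ler_norm_sum _ _ _)).
  apply: (@le_trans _ _ (\sum_(i < N) (d%:R : R))); last first.
    by rewrite sumr_const card_ord mulr_natl.
  apply: ler_sum => i _; rewrite -[leRHS]mulr1.
  exact: sum_period_error.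
have := sum_period_error i0 N d0 gd gM; rewrite sg mulr0 subr0 => h.
rewrite normrM normr_nat; apply: (le_trans (ler_wpM2l _ h)) => //.
by rewrite mulrA mulrC ler_wpM2l // -natrM ler_nat leq_trunc_div.
Qed.

Lemma box_coprime p q phi psi : (0 < q)%N -> coprime p q ->
  has_period2 p phi -> has_period2 q psi ->
  box (p * q) 0 0 (fun i j => phi i j * psi i j) = box p 0 0 phi * box q 0 0 psi.
Proof.
move=> q0 pq [phi1 phi2] [psi1 psi2]; rewrite /box.
transitivity (\sum_(i < p * q) (\sum_(j < p) phi i j) * (\sum_(j < q) psi i j)).
  apply: eq_bigr => i _; rewrite -(sum_coprime_periods q0 pq (phi2 i) (psi2 i)).
  by apply: eq_bigr => j _; rewrite !add0n.
rewrite (@sum_coprime_periods p q (fun i => \sum_(j < p) phi i j)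
   (fun i => \sum_(j < q) psi i j)) //.
- by move=> i; apply: eq_bigr => j _; apply: phi1.
- by move=> i; apply: eq_bigr => j _; apply: psi1.
Qed.

Lemma box_sum N i0 j0 (I : Type) (r : seq I) (P : pred I) (f : I -> nat -> nat -> R) :
  box N i0 j0 (fun i j => \sum_(k <- r | P k) f k i j)
  = \sum_(k <- r | P k) box N i0 j0 (f k).
Proof.
rewrite /box [RHS]exchange_big /=; apply: eq_bigr => i _.
by rewrite exchange_big.
Qed.

Lemma boxZ N i0 j0 (c : R) phi :
  box N i0 j0 (fun i j => c * phi i j) = c * box N i0 j0 phi.
Proof.
rewrite /box mulr_sumr; apply: eq_bigr => i _; rewrite mulr_sumr; exact: eq_bigr.
Qed.

Lemma eq_box N i0 j0 phi psi : (forall i j, phi i j = psi i j) ->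
  box N i0 j0 phi = box N i0 j0 psi.
Proof. by move=> e; apply: eq_bigr => i _; apply: eq_bigr => j _. Qed.

Lemma boxD N i0 j0 phi psi : box N i0 j0 (fun i j => phi i j + psi i j)
  = box N i0 j0 phi + box N i0 j0 psi.
Proof. by rewrite /box -big_split; apply: eq_bigr => i _; rewrite -big_split. Qed.

Lemma box_const N i0 j0 (c : R) : box N i0 j0 (fun _ _ => c) = N%:R ^+ 2 * c.
Proof.
rewrite /box; under eq_bigr => i _ do rewrite sumr_const card_ord.
by rewrite sumr_const card_ord -mulrnA mulnn -[LHS]mulr_natl natrX.
Qed.

Lemma ler_box N i0 j0 phi psi : (forall i j, phi i j <= psi i j) ->
  box N i0 j0 phi <= box N i0 j0 psi.
Proof. by move=> e; apply: ler_sum => i _; apply: ler_sum => j _. Qed.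

(** Expanding the square, the off-diagonal terms are complete-period sums of
products of centred functions with coprime periods, so they cancel up to the boundary
error 2 p q N; the diagonal gives the main term. The boundary error is harmless
when N is a large power of P. *)
Lemma turan_kubilius (ps : seq nat) (P N i0 j0 : nat)
  (delta : nat -> nat -> nat -> R) (theta rho : nat -> R) (c : R) :
  uniq ps -> (size ps <= P)%N -> (forall p, p \in ps -> prime p && (p <= P)%N) ->
  (forall p, p \in ps -> has_period2 p (delta p)) ->
  (forall p i j, 0 <= delta p i j <= 1) ->
  (forall p, p \in ps -> rho p = box p 0 0 (delta p) / p%:R ^+ 2) ->
  (forall p, `|theta p| <= 4) ->
  (forall p, p \in ps -> rho p <= c / p%:R) ->
  (forall p, p \in ps -> box N i0 j0 (delta p) <= c * N%:R ^+ 2 / p%:R) ->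
  box N i0 j0 (fun i j => (\sum_(p <- ps) theta p * (delta p i j - rho p)) ^+ 2)
  <= 2 * c * N%:R ^+ 2 * \sum_(p <- ps) theta p ^+ 2 / p%:R
     + 32 * P%:R ^+ 4 * N%:R.
Proof.
move=> ups sP psP dper d01 rhoE th4 rhoc boxc.
pose D p i j := delta p i j - rho p.
have rho01 p : p \in ps -> 0 <= rho p <= 1.
  move=> pps; have /andP[pp _] := psP _ pps; rewrite rhoE //.
  have p0 : (0 : R) < p%:R ^+ 2 by rewrite exprn_gt0 // ltr0n prime_gt0.
  apply/andP; split.
    apply: divr_ge0; last exact: ltW.
    by apply: sumr_ge0 => i _; apply: sumr_ge0 => j _; case/andP: (d01 p (0 + i)%N (0 + j)%N).
  rewrite ler_pdivrMr // mul1r -[leRHS]mulr1 -(box_const p 0 0).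
  by apply: ler_box => i j; case/andP: (d01 p i j).
have D1 p i j : p \in ps -> `|D p i j| <= 1.
  move=> /rho01; have := d01 p i j; rewrite /D ler_norml; lra.
have D2 p i j : p \in ps -> D p i j ^+ 2 <= delta p i j + rho p.
  by move=> /rho01; have := d01 p i j; rewrite /D; nra.
have Dper p : p \in ps -> has_period2 p (D p).
  move=> /dper [h1 h2]; split=> i j; rewrite /D; last by rewrite (h2 i j).
  by congr (_ - _); apply: h1.
have D0 p : p \in ps -> box p 0 0 (D p) = 0.
  move=> pps; have /andP[pp _] := psP _ pps.
  have p0 : (p%:R ^+ 2 : R) != 0 by rewrite expf_neq0 // pnatr_eq0 -lt0n prime_gt0.
  rewrite (boxD _ _ _ (delta p) (fun _ _ => - rho p)) box_const rhoE //.
  by rewrite mulrN mulrCA mulfV // mulr1 subrr.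
have -> : box N i0 j0 (fun i j => (\sum_(p <- ps) theta p * (delta p i j - rho p)) ^+ 2)
    = \sum_(p <- ps) \sum_(q <- ps) theta p * theta q
         * box N i0 j0 (fun i j => D p i j * D q i j).
  under eq_bigr => p _ do under eq_bigr => q _ do rewrite -boxZ.
  under eq_bigr => p _ do rewrite -box_sum.
  rewrite -box_sum; apply: eq_box => i j; rewrite expr2 big_distrlr /=.
  by apply: eq_bigr => p _; apply: eq_bigr => q _; rewrite /D; ring.
apply: (@le_trans _ _ (\sum_(p <- ps) (2 * c * N%:R ^+ 2 * (theta p ^+ 2 / p%:R)
     + P%:R * (32 * P%:R ^+ 2 * N%:R)))); last first.
  rewrite big_split /= mulr_sumr lerD2l big_const_seq count_predT iter_addr_0.
  rewrite -[leLHS]mulr_natl.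
  rewrite [leRHS](_ : _ = P%:R * (P%:R * (32 * P%:R ^+ 2 * N%:R))); last by ring.
  by rewrite ler_wpM2r ?ler_nat // !mulr_ge0 // exprn_ge0.
rewrite big_seq [leRHS]big_seq; apply: ler_sum => p pps.
rewrite (bigD1_seq p) //=; apply: lerD.
  rewrite -expr2 (_ : 2 * c * N%:R ^+ 2 * (theta p ^+ 2 / p%:R)
     = theta p ^+ 2 * (c * N%:R ^+ 2 / p%:R + N%:R ^+ 2 * (c / p%:R))); last by ring.
  apply: ler_wpM2l; first exact: sqr_ge0.
  apply: (@le_trans _ _ (box N i0 j0 (fun i j => delta p i j + rho p))).
    by apply: ler_box => i j; rewrite -expr2; apply: D2.
  by rewrite boxD box_const lerD ?boxc // ler_wpM2l ?sqr_ge0 ?rhoc.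
apply: (@le_trans _ _ (\sum_(q <- ps) 32 * P%:R ^+ 2 * N%:R)); last first.
  rewrite big_const_seq count_predT iter_addr_0 -[leLHS]mulr_natl.
  apply: ler_wpM2r; last by rewrite ler_nat.
  by apply: mulr_ge0 => //; apply: mulr_ge0 => //; apply: exprn_ge0.
apply: (@le_trans _ _ (\sum_(q <- ps | q != p) 32 * P%:R ^+ 2 * N%:R)); last first.
  rewrite [leRHS](bigID (fun q => q != p)) /= lerDl.
  by apply: sumr_ge0 => q _; rewrite !mulr_ge0 // exprn_ge0.
rewrite [leLHS]big_seq_cond [leRHS]big_seq_cond; apply: ler_sum => q /andP[qps qp].
have /andP[pp pP] := psP _ pps; have /andP[qq qP] := psP _ qps.
apply: (le_trans (ler_norm _)); rewrite !normrM.
rewrite (_ : 32 * _ * _ = 4 * 4 * (2 * (P%:R ^+ 2) * N%:R)); last by ring.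
apply: ler_pM; [exact: mulr_ge0|exact: normr_ge0|by apply: ler_pM|].
have pq : coprime p q by rewrite prime_coprime // dvdn_prime2 // eq_sym.
apply: (le_trans (@box_period_sum0 (p * q) _ _ _ _ _ _ _ _)).
- by rewrite muln_gt0 !prime_gt0.
- have [h1 h2] := Dper _ pps; have [h3 h4] := Dper _ qps.
  split=> i j /=; congr (_ * _).
  + by rewrite mulnC; apply: (has_periodM q (h1 i)).
  + by apply: (has_periodM p (h3 i)).
  + by rewrite mulnC; apply: (has_periodM q (h2 i)).
  + by apply: (has_periodM p (h4 i)).
- by move=> i j; rewrite normrM mulr_ile1 // D1.
- by rewrite box_coprime ?prime_gt0 // ?D0 ?mul0r //; apply: Dper.
by rewrite ler_wpM2r // ler_wpM2l // -natrX ler_nat -mulnn leq_mul.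
Qed.

End PeriodicSums.

(** * Sampling values of a form *)

Lemma two_prime_count (p N z : nat) : (p ^ 2 <= N)%N ->
  (z <= 4 * (N * (N %/ p ^ 2).+1) + (N %/ p).+1 ^ 2)%N ->
  (p ^ 2 * z <= 12 * N ^ 2)%N.
Proof.
move=> pN hz.
have h1 : (p ^ 2 * (N %/ p ^ 2).+1 <= 2 * N)%N.
  by rewrite mulnS addnC mul2n -addnn leq_add // mulnC leq_trunc_div.
have h2 : (p * (N %/ p).+1 <= 2 * N)%N.
  rewrite mulnS addnC mul2n -addnn leq_add // 1?mulnC ?leq_trunc_div //.
  exact: leq_trans (leq_sqr p) pN.
apply: (@leq_trans (p ^ 2 * (4 * (N * (N %/ p ^ 2).+1) + (N %/ p).+1 ^ 2))).
  by rewrite leq_mul2l hz orbT.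
rewrite mulnDr -expnMn (_ : 12 * N ^ 2 = 4 * N * (2 * N) + (2 * N) ^ 2)%N; last first.
  by rewrite expnMn -mulnn; ring.
apply: leq_add; last by rewrite leq_exp2r.
rewrite (_ : p ^ 2 * _ = 4 * N * (p ^ 2 * (N %/ p ^ 2).+1))%N; last by ring.
by rewrite leq_mul2l h1 orbT.
Qed.

Lemma one_prime_count (p N z : nat) : (0 < N)%N -> (p <= N)%N ->
  (z <= 4 * (N * (N %/ p).+1) + (N %/ p).+1 ^ 2)%N ->
  (p * z <= 12 * N ^ 2)%N.
Proof.
move=> N0 pN hz; apply: (mid_prime_bound (K := 2) hz).
  by rewrite mulnS addnC mul2n -addnn leq_add // mulnC leq_trunc_div.
by rewrite mul2n -addnn -addn1 leq_add // leq_div.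
Qed.

Section PrimeDensities.
Variable R : realType.
Implicit Types (F : int * int * int) (theta : nat -> R).

Definition primes_in (w P : nat) : seq nat :=
  [seq p <- index_iota w.+1 P.+1 | prime p].

Lemma mem_primes_in w P p : (p \in primes_in w P) = [&& prime p, (w < p)%N & (p <= P)%N].
Proof. by rewrite mem_filter mem_index_iota ltnS. Qed.

Lemma uniq_primes_in w P : uniq (primes_in w P).
Proof. by rewrite filter_uniq // iota_uniq. Qed.

Lemma size_primes_in w P : (size (primes_in w P) <= P)%N.
Proof.
rewrite size_filter (leq_trans (count_size _ _)) // size_iota subSS.
exact: leq_subr.
Qed.

Lemma primes_in_cat w v P : (w <= v)%N -> (v <= P)%N ->
  primes_in w P = primes_in w v ++ primes_in v P.
Proof.
move=> wv vP; rewrite -filter_cat; congr (seq.filter _ _).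
rewrite /index_iota !subSS (_ : P - w = (v - w) + (P - v))%N.
  by rewrite iotaD addSn subnKC.
by rewrite addnC addnBA // subnK.
Qed.

Definition zero_ind F (d : nat) (m n : nat) : R := ((d%:Z %| qform F m%:Z n%:Z)%Z)%:R.

Definition density F (p : nat) : R := box p 0 0 (zero_ind F p) / p%:R ^+ 2.

(** Its increments are the means around which the contribution of the primes between
two bounds is concentrated. *)
Definition drift F theta (P : nat) : R :=
  \sum_(p <- primes_in 0 P) theta p * density F p.

Lemma driftB F theta w P : (w <= P)%N ->
  drift F theta P - drift F theta w
  = \sum_(p <- primes_in w P) theta p * density F p.
Proof. by move=> wP; rewrite /drift (primes_in_cat (leq0n w) wP) big_cat addrC addKr. Qed.

(** Cauchy's criterion for the series of the theta_p^2 / p. *)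
Definition prime_tails_vanish theta := forall e : R, 0 < e -> exists w0 : nat,
  forall w P : nat, (w0 <= w)%N ->
    \sum_(p <- primes_in w P) theta p ^+ 2 / p%:R <= e.

Lemma zero_ind_eq F (d m n m' n' : nat) :
  (d%:Z %| m%:Z - m'%:Z)%Z -> (d%:Z %| n%:Z - n'%:Z)%Z ->
  zero_ind F d m n = zero_ind F d m' n'.
Proof.
move=> hm hn; rewrite /zero_ind.
have h : (d%:Z %| qform F m n - qform F m' n')%Z.
  rewrite (_ : _ - _ = (m%:Z - m'%:Z) * (F.1.1 * (m%:Z + m'%:Z) + F.1.2 * n%:Z)
     + (n%:Z - n'%:Z) * (F.1.2 * m'%:Z + F.2 * (n%:Z + n'%:Z))); last first.
    by rewrite /qform; ring.
  by rewrite rpredD // dvdz_mulr.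
by rewrite -[qform F m n](subrK (qform F m' n')) rpredDl.
Qed.

Lemma zero_ind_period F A1 B1 A2 B2 d :
  has_period2 d (fun i j => zero_ind F d (A1 + B1 * i) (A2 + B2 * j)).
Proof.
split=> i j; apply: zero_ind_eq; rewrite ?subrr ?dvdz0 //.
  rewrite mulnDr addnA PoszD addrC addKr.
  by rewrite PoszM dvdz_mull.
rewrite mulnDr addnA PoszD addrC addKr.
by rewrite PoszM dvdz_mull.
Qed.

Lemma zero_ind_period0 F d : has_period2 d (zero_ind F d).
Proof.
have [h1 h2] := zero_ind_period F 0 1 0 1 d.
split=> [j i|i j]; first by have := h1 j i; rewrite !mul1n.
by have := h2 i j; rewrite !mul1n.
Qed.

(** The means thus depend on the form only, not on the progressions, whose moduli
grow with w: this is what makes the pigeonhole argument possible. *)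
Lemma density_progression F A1 B1 A2 B2 p : prime p ->
  ~~ (p %| B1)%N -> ~~ (p %| B2)%N ->
  density F p = box p 0 0 (fun i j => zero_ind F p (A1 + B1 * i) (A2 + B2 * j))
     / p%:R ^+ 2.
Proof.
move=> pp pB1 pB2; congr (_ / _).
have [h1 h2] := zero_ind_period0 F p.
have cB b : ~~ (p %| b)%N -> coprime b p by rewrite coprime_sym prime_coprime.
have p0 := prime_gt0 pp.
rewrite /box; transitivity (\sum_(i < p) \sum_(j < p) zero_ind F p i j) => //.
rewrite -(@sum_affine _ p (fun i => \sum_(j < p) zero_ind F p i j) A1 B1) ?cB //; last first.
  by move=> i; apply: eq_bigr => j _; apply: h1.
apply: eq_bigr => i _; by rewrite -(@sum_affine _ p (zero_ind F p _) A2 B2) ?cB //; apply: h2.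
Qed.

Lemma box_zero_ind F A1 B1 A2 B2 N i0 j0 d :
  box N i0 j0 (fun i j => zero_ind F d (A1 + B1 * i) (A2 + B2 * j))
  = #|[pred v : 'I_N * 'I_N | (d%:Z %| qform F
        (A1 + B1 * (i0 + v.1))%N%:Z (A2 + B2 * (j0 + v.2))%N%:Z)%Z]|%:R.
Proof.
rewrite /box pair_big /= -sum1_card natr_sum [RHS]big_mkcond /=.
by apply: eq_bigr => v _; rewrite inE /zero_ind; case: (_ %| _)%Z.
Qed.

Lemma ler_nat_div (a b c : nat) : (0 < a)%N -> (a * b <= c)%N ->
  (b%:R : R) <= c%:R / a%:R.
Proof.
by move=> a0 h; rewrite ler_pdivlMr ?ltr0n // -natrM ler_nat mulnC.
Qed.

Section OneForm.
Variables (F : int * int * int) (A1 B1 A2 B2 : nat).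
Let ind (d : nat) (i j : nat) : R := zero_ind F d (A1 + B1 * i) (A2 + B2 * j).

Lemma box_ind_small p N i0 j0 : prime p -> ~~ (p%:Z %| qdisc F)%Z ->
  ~~ (p %| B1)%N -> ~~ (p %| B2)%N -> (p <= N)%N ->
  box N i0 j0 (ind p) <= 12 * N%:R ^+ 2 / p%:R.
Proof.
move=> pp pD pB1 pB2 pN.
rewrite /ind box_zero_ind -natrX -natrM; apply: ler_nat_div; first exact: prime_gt0.
apply: one_prime_count => //; first exact: leq_trans (prime_gt0 pp) pN.
by have := card_qform_dvd (e := 1) A1 A2 i0 j0 N pp isT pD pB1 pB2; rewrite expn1.
Qed.

Lemma box_ind_square p N i0 j0 : prime p -> ~~ (p%:Z %| qdisc F)%Z ->
  ~~ (p %| B1)%N -> ~~ (p %| B2)%N -> (p ^ 2 <= N)%N ->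
  box N i0 j0 (ind (p ^ 2)) <= 12 * N%:R ^+ 2 / p%:R ^+ 2.
Proof.
move=> pp pD pB1 pB2 pN.
rewrite /ind box_zero_ind -!natrX -natrM; apply: ler_nat_div.
  by rewrite expn_gt0 prime_gt0.
apply: two_prime_count => //.
exact: (card_qform_dvd (e := 2) A1 A2 i0 j0 N pp isT pD pB1 pB2).
Qed.
End OneForm.

Lemma density_le F p : prime p -> ~~ (p%:Z %| qdisc F)%Z -> density F p <= 12 / p%:R.
Proof.
move=> pp pD.
have p1 : ~~ (p %| 1)%N by rewrite gtnNdvd // prime_gt1.
have p0 : (0 : R) < p%:R ^+ 2 by rewrite exprn_gt0 // ltr0n prime_gt0.
rewrite (density_progression F 0 0 pp p1 p1) ler_pdivrMr // mulrAC.
exact: box_ind_small.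
Qed.

(** Comparison with the telescoping series of 1 / (k (k - 1)). *)
Lemma sum_inv_sqr_le w P : (0 < w)%N ->
  \sum_(p <- primes_in w P) (p%:R ^+ 2)^-1 <= w%:R^-1 :> R.
Proof.
move=> w0; have [Pw|wP] := leqP P w.
  rewrite (_ : primes_in w P = [::]); first by rewrite big_nil invr_ge0.
  by rewrite /primes_in /index_iota (eqP (_ : P.+1 - w.+1 == 0)%N) // subSS subn_eq0.
rewrite big_filter big_mkcond /=.
apply: (@le_trans _ _ (\sum_(w.+1 <= k < P.+1) (k.-1%:R^-1 - k%:R^-1))); last first.
  rewrite (telescope_sumr_eq (fun k => - k.-1%:R^-1)) /=; [|by rewrite ltnW|].
    by rewrite opprK addrC lerBlDr lerDl invr_ge0.
  by move=> k _; rewrite opprK addrC.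
rewrite big_nat [leRHS]big_nat; apply: ler_sum => k /andP[wk _].
have k1 : (0 : R) < k.-1%:R by rewrite ltr0n; case: k wk => [|[|k]] //; case: (w) w0.
have kE : k%:R = k.-1%:R + 1 :> R by rewrite -{1}(prednK (leq_ltn_trans (leq0n w) wk)) -natr1.
have h : (k%:R ^+ 2)^-1 <= k.-1%:R^-1 - k%:R^-1 :> R.
  rewrite kE -subr_ge0 (_ : _ - _ = (k.-1%:R * (k.-1%:R + 1) ^+ 2)^-1); last first.
    by field; rewrite !gt_eqF //; lra.
  by rewrite invr_ge0 mulr_ge0 ?ltW // exprn_gt0 // addr_gt0.
case: (prime k) => //; apply: le_trans h; rewrite invr_ge0 sqr_ge0 //.
Qed.

Lemma archi_inv (c e : R) : 0 < e -> exists n0 : nat, forall n : nat, (n0 <= n)%N ->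
  (0 < n)%N /\ c / n%:R <= e.
Proof.
move=> e0; exists (Num.bound (`|c| / e)).+1 => n hn.
have n0 : (0 < n)%N by apply: leq_trans hn.
split=> //; rewrite ler_pdivrMr ?ltr0n // (le_trans (ler_norm c)) //.
rewrite mulrC -ler_pdivrMr //; apply/ltW.
apply: (lt_le_trans (archi_boundP _)); first by rewrite divr_ge0 // ltW.
by rewrite ler_nat ltnW.
Qed.

End PrimeDensities.

Section AverageDefect.
Variable R : realType.
Implicit Types (F : int * int * int) (theta : nat -> R).

(** What has to be small at a good point: the deviation from the mean over the
primes up to P, the number of those primes with a square dividing the value,
and theta at the larger prime factors. *)
Definition defect F theta (w P M m n : nat) : R :=
  (\sum_(p <- primes_in w P) theta p * (zero_ind R F p m n - density R F p)) ^+ 2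
  + \sum_(p <- primes_in w P) zero_ind R F (p ^ 2) m n
  + \sum_(p <- primes_in P M) zero_ind R F p m n * theta p ^+ 2.

(** The order of the quantifiers matters: w is chosen from the form and theta
alone, before the progressions, and the bound P0 afterwards, because the constant C
for the large primes depends on the progressions. *)
Lemma box_defect_small F theta : qdisc F != 0 -> (forall p, `|theta p| <= 4) ->
  prime_tails_vanish theta -> forall xi : R, 0 < xi ->
  exists w0 : nat, forall w : nat, (w0 <= w)%N ->
  forall A1 B1 A2 B2 C0 : nat, (0 < B1)%N -> (0 < B2)%N ->
  (forall p, prime p -> (w < p)%N -> ~~ (p %| B1)%N && ~~ (p %| B2)%N) ->
  exists P0 : nat, forall P : nat, (P0 <= P)%N ->
  forall i0 j0 M : nat, (i0 <= C0 * P ^ 6)%N -> (j0 <= C0 * P ^ 6)%N ->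
  (forall i j, (i < P ^ 6)%N -> (j < P ^ 6)%N ->
     (0 < A2 + B2 * (j0 + j))%N /\
     qform F (A1 + B1 * (i0 + i))%N%:Z (A2 + B2 * (j0 + j))%N%:Z != 0) ->
  box (P ^ 6) i0 j0 (fun i j => defect F theta w P M (A1 + B1 * i) (A2 + B2 * j))
  <= xi * (P ^ 6)%N%:R ^+ 2.
Proof.
move=> D0 th4 tails xi xi0.
have xi4 : 0 < xi / 4 by rewrite divr_gt0.
have xi96 : 0 < xi / 96 by rewrite divr_gt0.
have [w1 hw1] := tails _ xi96.
have [w2 hw2] := archi_inv (12 : R) xi4.
exists (maxn (maxn w1 w2) `|qdisc F|%N) => w.
rewrite !geq_max => /andP[/andP[w1w w2w] Dw] A1 B1 A2 B2 C0 B10 B20 hB.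
have [C hC] := card_qform_large A1 A2 D0 B10 B20 C0.
(* the tail beyond P also absorbs the constant C *)
have C10 : (0 : R) < C%:R + 1 by rewrite ltr_wpDl.
have [P1 hP1] := tails _ (divr_gt0 xi4 C10).
have [P2 hP2] := archi_inv (32 : R) xi4.
exists (maxn (maxn P1 P2) (maxn w C)) => P.
rewrite !geq_max => /andP[/andP[P1P P2P] /andP[wP CP]] i0 j0 M hi0 hj0 nz.
have [Ppos hP2'] := hP2 _ P2P; have [wpos hw2'] := hw2 _ w2w.
set N := (P ^ 6)%N; rewrite -/N in hi0 hj0 nz *.
have N0 : (0 < N)%N by rewrite expn_gt0 Ppos.
have pD p : prime p -> (w < p)%N -> ~~ (p%:Z %| qdisc F)%Z.
  move=> pp wp; rewrite dvdzE gtnNdvd // ?absz_gt0 //.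
  exact: leq_ltn_trans wp.
have PN k : (k <= 6)%N -> (P ^ k <= N)%N by move=> k6; rewrite leq_pexp2l.
rewrite /defect !boxD !box_sum.
rewrite (_ : xi * N%:R ^+ 2 = N%:R ^+ 2 * (xi / 4 + xi / 4) + N%:R ^+ 2 * (xi / 4)
  + N%:R ^+ 2 * (xi / 4)); last by field.
have NN0 : (0 : R) <= N%:R ^+ 2 by rewrite sqr_ge0.
apply: lerD; first apply: lerD.
- apply: (le_trans (@turan_kubilius R (primes_in w P) P N i0 j0
    (fun p i j => zero_ind R F p (A1 + B1 * i) (A2 + B2 * j)) theta (density R F) 12
    _ _ _ _ _ _ _ _ _)).
  + exact: uniq_primes_in.
  + exact: size_primes_in.
  + by move=> p; rewrite mem_primes_in => /and3P[-> _ ->].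
  + by move=> p _; apply: zero_ind_period.
  + by move=> p i j; rewrite /zero_ind; case: (_ %| _)%Z; rewrite /= ?lexx ?ler01.
  + move=> p; rewrite mem_primes_in => /and3P[pp wp _].
    by case/andP: (hB _ pp wp) => ? ?; apply: density_progression.
  + exact: th4.
  + by move=> p; rewrite mem_primes_in => /and3P[pp wp _]; apply: density_le; auto.
  + move=> p; rewrite mem_primes_in => /and3P[pp wp pP].
    case/andP: (hB _ pp wp) => ? ?; apply: box_ind_small; rewrite ?pD //.
    by apply: (leq_trans pP); have := PN 1%N isT; rewrite expn1.
  rewrite [leRHS]mulrDr; apply: lerD.
    rewrite (_ : 2 * 12 * N%:R ^+ 2 = N%:R ^+ 2 * 24); last by ring.
    rewrite -mulrA ler_wpM2l //; have := hw1 w P w1w; lra.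
  rewrite (_ : 32 * P%:R ^+ 4 * N%:R = N%:R ^+ 2 * (32 / P%:R ^+ 2)); last first.
    rewrite /N natrX; field; by rewrite pnatr_eq0 -lt0n.
  rewrite ler_wpM2l // (le_trans _ hP2') // ler_wpM2l // lef_pV2 ?posrE ?exprn_gt0 ?ltr0n //.
  by rewrite -natrX ler_nat leq_sqr.
- apply: (@le_trans _ _ (N%:R ^+ 2 * (12 * \sum_(p <- primes_in w P) (p%:R ^+ 2)^-1))).
    rewrite !mulr_sumr big_seq [leRHS]big_seq; apply: ler_sum => p.
    rewrite mem_primes_in => /and3P[pp wp pP]; case/andP: (hB _ pp wp) => ? ?.
    rewrite mulrA (mulrC (N%:R ^+ 2)); apply: box_ind_square; rewrite ?pD //.
    by apply: leq_trans (PN 2 isT); rewrite leq_exp2r.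
  rewrite ler_wpM2l // (le_trans _ hw2') // ler_wpM2l //.
  exact: sum_inv_sqr_le.
- apply: (@le_trans _ _ (N%:R ^+ 2 * (C%:R * \sum_(p <- primes_in P M) theta p ^+ 2 / p%:R))).
    rewrite !mulr_sumr big_seq [leRHS]big_seq; apply: ler_sum => p.
    rewrite mem_primes_in => /and3P[pp Pp pM].
    under eq_box => i j do rewrite mulrC.
    rewrite boxZ box_zero_ind.
    rewrite (_ : N%:R ^+ 2 * _ = theta p ^+ 2 * (C%:R * N%:R ^+ 2 / p%:R)); last by ring.
    rewrite ler_wpM2l ?sqr_ge0 // -natrX -natrM; apply: ler_nat_div.
      exact: prime_gt0.
    by apply: hC => //; apply: leq_ltn_trans CP _.
  rewrite ler_wpM2l //.
  apply: (@le_trans _ _ ((C%:R + 1) * (xi / 4 / (C%:R + 1)))).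
    apply: ler_pM => //; first by apply: sumr_ge0 => p _; rewrite divr_ge0 ?sqr_ge0.
      by rewrite lerDl.
    exact: hP1.
  by rewrite mulrC divfK // gt_eqF.
Qed.

End AverageDefect.

Lemma eventually_all (T : finType) (Q : T -> nat -> Prop) :
  (forall x, exists n0, forall n, (n0 <= n)%N -> Q x n) ->
  exists n0, forall n, (n0 <= n)%N -> forall x, Q x n.
Proof.
move=> /boolp.choice[h hP]; exists (\max_x h x) => n hn x.
by apply: hP; apply: leq_trans hn; apply: leq_bigmax.
Qed.

Section SamplePoint.
Variable R : realType.
Implicit Types (F : int * int * int) (theta : nat -> R).

Lemma box_exists_lt N i0 j0 (phi : nat -> nat -> R) (c : R) :
  box N i0 j0 phi < N%:R ^+ 2 * c ->
  exists i j, [/\ (i < N)%N, (j < N)%N & phi (i0 + i)%N (j0 + j)%N < c].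
Proof.
move=> h; apply: contrapT => hn; move: h; apply/negP; rewrite -leNgt.
rewrite -(box_const N i0 j0); apply: ler_sum => i _; apply: ler_sum => j _.
rewrite leNgt; apply/negP => hij; apply: hn.
by exists i, j; split.
Qed.

(** All defects are small at once at some point, since their sum has a small average
over the box. The bound 1 / 2 in the threshold excludes square factors, whose
number is an integer. *)
Lemma sample_point (J : finType) (F : J -> int * int * int) (theta : J -> nat -> R) :
  (forall x, qdisc (F x) != 0) -> (forall x p, `|theta x p| <= 4) ->
  (forall x, prime_tails_vanish (theta x)) -> forall kappa : R, 0 < kappa ->
  exists w0 : nat, forall w : nat, (w0 <= w)%N ->
  forall A1 B1 A2 B2 C0 : nat, (0 < B1)%N -> (0 < B2)%N ->
  (forall p, prime p -> (w < p)%N -> ~~ (p %| B1)%N && ~~ (p %| B2)%N) ->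
  exists P0 : nat, forall P : nat, (P0 <= P)%N ->
  forall i0 j0 : nat, (i0 <= C0 * P ^ 6)%N -> (j0 <= C0 * P ^ 6)%N ->
  (forall i j x, (i < P ^ 6)%N -> (j < P ^ 6)%N ->
     (0 < A2 + B2 * (j0 + j))%N /\
     qform (F x) (A1 + B1 * (i0 + i))%N%:Z (A2 + B2 * (j0 + j))%N%:Z != 0) ->
  exists i j, [/\ (i < P ^ 6)%N, (j < P ^ 6)%N & forall x,
    let m := (A1 + B1 * (i0 + i))%N in let n := (A2 + B2 * (j0 + j))%N in
    [/\ forall p, prime p -> (w < p)%N -> (p <= P)%N ->
          ~~ ((p ^ 2)%N%:Z %| qform (F x) m%:Z n%:Z)%Z,
        `|\sum_(p <- primes_in w P) theta x p * zero_ind R (F x) p m n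
          - (drift (F x) (theta x) P - drift (F x) (theta x) w)| <= kappa
      & forall p, prime p -> (P < p)%N -> (p%:Z %| qform (F x) m%:Z n%:Z)%Z ->
          `|theta x p| <= kappa]].
Proof.
move=> D0 th4 tails kappa kappa0.
pose c : R := Num.min (kappa ^+ 2) (1 / 2).
have c0 : 0 < c by rewrite lt_min exprn_gt0 //=; lra.
pose xi : R := c / (#|J|%:R + 1).
have J0 : (0 : R) < #|J|%:R + 1 by rewrite ltr_wpDl.
have xi0 : 0 < xi by apply: divr_gt0.
have [w0 hw0] := eventually_all (fun x => box_defect_small (D0 x) (th4 x) (tails x) xi0).
exists w0 => w ww A1 B1 A2 B2 C0 B10 B20 hB.
have [P1 hP1] := eventually_all (fun x => hw0 w ww x A1 B1 A2 B2 C0 B10 B20 hB).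
exists (maxn (maxn P1 w) 1) => P; rewrite !geq_max => /andP[/andP[P1P wP] P0].
move=> i0 j0 hi0 hj0 nz.
set N := (P ^ 6)%N; rewrite -/N in hi0 hj0 nz *.
have N0 : (0 < N)%N by rewrite expn_gt0 P0.
pose V x i j := qform (F x) (A1 + B1 * (i0 + i))%N%:Z (A2 + B2 * (j0 + j))%N%:Z.
(* every prime dividing a value on the box is at most M *)
pose M := \max_(x : J) \max_(i < N) \max_(j < N) `|V x i j|%N.
have VM x (i j : nat) : (i < N)%N -> (j < N)%N -> (`|V x i j| <= M)%N.
  move=> iN jN; apply: leq_trans (leq_bigmax x).
  apply: leq_trans (leq_bigmax (Ordinal iN)).
  exact: leq_trans (leq_bigmax (Ordinal jN)).
have : box N i0 j0 (fun i j => \sum_x defect (F x) (theta x) w P M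
    (A1 + B1 * i) (A2 + B2 * j)) < N%:R ^+ 2 * c.
  rewrite box_sum.
  apply: (@le_lt_trans _ _ (\sum_(x : J) xi * N%:R ^+ 2)).
    apply: ler_sum => x _; apply: hP1 => // i j iN jN; exact: nz.
  rewrite sumr_const -[ltLHS]mulr_natl mulrA mulrC ltr_pM2l ?exprn_gt0 ?ltr0n //.
  by rewrite /xi mulrCA gtr_pMr // ltr_pdivrMr // mul1r ltrDl.
case/box_exists_lt => i [j [iN jN hlt]]; exists i, j; split=> // x m n.
have zi0 G d a b : 0 <= zero_ind R G d a b.
  by rewrite /zero_ind; case: (_ %| _)%Z.
have part x' : [/\ 0 <= (\sum_(p <- primes_in w P)
     theta x' p * (zero_ind R (F x') p m n - density R (F x') p)) ^+ 2,
    0 <= \sum_(p <- primes_in w P) zero_ind R (F x') (p ^ 2) m n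
  & 0 <= \sum_(p <- primes_in P M) zero_ind R (F x') p m n * theta x' p ^+ 2].
  split; first exact: sqr_ge0.
    by apply: sumr_ge0.
  by apply: sumr_ge0 => p _; rewrite mulr_ge0 // sqr_ge0.
have : defect (F x) (theta x) w P M m n < c.
  apply: le_lt_trans hlt; rewrite (bigD1 x) //= lerDl; apply: sumr_ge0 => x' _.
  by have [h1 h2 h3] := part x'; rewrite !addr_ge0.
have [h1 h2 h3] := part x; rewrite /defect lt_min => /andP[lt1 lt2].
split.
- move=> p pp wp pP; apply/negP => pF.
  have : 1 <= \sum_(p <- primes_in w P) zero_ind R (F x) (p ^ 2) m n.
    rewrite (bigD1_seq p) ?uniq_primes_in ?mem_primes_in ?pp ?wp //=.
    by rewrite {1}/zero_ind pF lerDl sumr_ge0.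
  move: h1 h2 h3 lt2; set a := (_ ^+ 2); lra.
- rewrite driftB // -sumrB.
  under eq_bigr => p _ do rewrite -mulrBr.
  rewrite -(@ler_pXn2r _ 2) ?nnegrE //; last exact: ltW.
  rewrite real_normK ?num_real //.
  by move: h1 h2 h3 lt1; set a := (_ ^+ 2); lra.
- move=> p pp Pp pF.
  have pM : (p <= M)%N.
    apply: leq_trans (VM x _ _ iN jN); apply: dvdn_leq; last by move: pF; rewrite dvdzE.
    by rewrite absz_gt0; case: (nz i j x iN jN).
  rewrite -(@ler_pXn2r _ 2) ?nnegrE //; last exact: ltW.
  rewrite real_normK ?num_real //.
  have : theta x p ^+ 2 <= \sum_(p <- primes_in P M) zero_ind R (F x) p m n * theta x p ^+ 2.
    rewrite (bigD1_seq p) ?uniq_primes_in ?mem_primes_in ?pp ?Pp //=.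
    rewrite {1}/zero_ind pF mul1r lerDl; apply: sumr_ge0 => q _.
    by rewrite mulr_ge0 // sqr_ge0.
  by move: h1 h2 h3 lt1; set a := (_ ^+ 2); lra.
Qed.

End SamplePoint.

(** * Additive functions and prime factorizations *)
Section Additive.
Variable R : realType.
Implicit Types (theta : nat -> R).

(** The completely additive function with values theta at the primes. *)
Definition additive_ext theta (g : nat) : R :=
  \sum_(p <- primes g) (logn p g)%:R * theta p.

Lemma prod_primes_logn g : (0 < g)%N -> g = (\prod_(p <- primes g) p ^ logn p g)%N.
Proof.
by move=> g0; rewrite {1}(prod_prime_decomp g0) prime_decompE big_map.
Qed.

Lemma sum_large_logn (g P k : nat) : (0 < g)%N -> (0 < P)%N -> (g < P ^ k.+1)%N ->
  (\sum_(p <- primes g | (P < p)%N) logn p g <= k)%N.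
Proof.
move=> g0 P0 gP; have [P1|P1] := ltnP 1 P; last first.
  have PE : P = 1%N by apply/eqP; rewrite eqn_leq P1.
  by move: gP; rewrite PE exp1n; case: (g) g0.
rewrite -ltnS -(@ltn_exp2l P) //; apply: leq_ltn_trans gP.
rewrite expn_sum [X in (_ <= X)%N](prod_primes_logn g0) [X in (_ <= X)%N](bigID (fun p => (P < p)%N)) /=.
apply: (@leq_trans (\prod_(p <- primes g | (P < p)%N) p ^ logn p g)).
  elim/big_ind2: _ => // [a b a' b' ha hb|p Pp]; first exact: leq_mul.
  by case: (logn p g) => // k'; rewrite leq_exp2r // ltnW.
apply: leq_pmulr; rewrite big_seq_cond; apply: prodn_cond_gt0 => p.
by rewrite mem_primes => /andP[/and3P[pp _ _] _]; rewrite expn_gt0 prime_gt0.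
Qed.

(** The prime factors up to P are simple, and there are at most k larger ones,
counted with multiplicity, since g < P ^ k.+1. *)
Lemma additive_ext_close theta (g w P k : nat) (kappa : R) :
  (0 < g)%N -> (0 < P)%N -> (w <= P)%N -> (g < P ^ k.+1)%N -> 0 <= kappa ->
  (forall p, prime p -> (p %| g)%N -> (w < p)%N) ->
  (forall p, prime p -> (w < p)%N -> (p <= P)%N -> ~~ (p ^ 2 %| g)%N) ->
  (forall p, prime p -> (P < p)%N -> (p %| g)%N -> `|theta p| <= kappa) ->
  `|additive_ext theta g - \sum_(p <- primes_in w P) theta p * (p %| g)%N%:R|
    <= k%:R * kappa.
Proof.
move=> g0 P0 wP gP kap0 hw hsq hlarge.
rewrite /additive_ext (bigID (fun p => (P < p)%N)) /=.
have -> : \sum_(p <- primes_in w P) theta p * (p %| g)%N%:R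
    = \sum_(p <- primes g | ~~ (P < p)%N) (logn p g)%:R * theta p.
  transitivity (\sum_(p <- [seq p <- primes_in w P | (p %| g)%N]) theta p).
    rewrite [RHS]big_filter [RHS]big_mkcond /=; apply: eq_bigr => p _.
    by case: (p %| g)%N; rewrite ?mulr1 ?mulr0.
  rewrite -[RHS]big_filter (perm_big [seq p <- primes g | ~~ (P < p)%N]) /=.
    rewrite big_seq [RHS]big_seq; apply: eq_bigr => p.
    rewrite mem_filter mem_primes -leqNgt => /and3P[pP pp /andP[_ pg]].
    have wp := hw _ pp pg.
    suff -> : logn p g = 1%N by rewrite mul1r.
    apply/eqP; rewrite eqn_leq logn_gt0 mem_primes pp g0 pg andbT leqNgt.
    by rewrite -pfactor_dvdn // hsq.
  apply: uniq_perm; rewrite ?filter_uniq ?iota_uniq ?primes_uniq //.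
  move=> p; rewrite !mem_filter mem_index_iota mem_primes g0 -leqNgt ltnS /=.
  case pg: (p %| g)%N; rewrite ?andbF //= ?andbT.
  by case pp: (prime p); rewrite ?andbF //= (hw _ pp pg) andbT.
rewrite addrK; apply: (le_trans (ler_norm_sum _ _ _)).
apply: (@le_trans _ _ (\sum_(p <- primes g | (P < p)%N) (logn p g)%:R * kappa)).
  rewrite big_seq_cond [leRHS]big_seq_cond; apply: ler_sum => p.
  rewrite mem_primes => /andP[/and3P[pp _ pg] Pp].
  by rewrite normrM normr_nat ler_wpM2l // hlarge.
by rewrite -mulr_suml -natr_sum ler_wpM2r // ler_nat sum_large_logn.
Qed.

End Additive.

(** * The circle *)

Section Circle.
Variable R : realType.
Local Notation C := R[i].

Lemma expiD (x y : R) : expi (x + y) = expi x * expi y.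
Proof.
rewrite /expi cosD sinD; apply/eqP; rewrite eq_complex /=.
by rewrite eqxx /=; apply/eqP; ring.
Qed.

Lemma expi0 : expi 0 = 1 :> C.
Proof. by rewrite /expi cos0 sin0. Qed.

Lemma expiNM (x : R) : expi (- x) * expi x = 1.
Proof. by rewrite -expiD addNr expi0. Qed.

Lemma expi_neq0 (x : R) : expi x != 0.
Proof.
apply/eqP => h; have := expiNM x; rewrite h mulr0 => /eqP.
by rewrite eq_sym oner_eq0.
Qed.

Lemma expiN (x : R) : expi (- x) = (expi x)^-1.
Proof. by apply: (mulIf (expi_neq0 x)); rewrite expiNM mulVf // expi_neq0. Qed.

Lemma expiX (x : R) n : expi x ^+ n = expi (n%:R * x).
Proof.
elim: n => [|n IH]; first by rewrite mul0r expi0 expr0.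
by rewrite exprS IH -expiD -natr1 mulrDl mul1r addrC.
Qed.

Lemma expi2pi : expi (pi *+ 2) = 1 :> C.
Proof. by rewrite /expi cos2pi sin2pi. Qed.

Lemma expi2piz (z : int) : expi (z%:~R * (pi *+ 2)) = 1 :> C.
Proof.
case: z => n; first by rewrite -pmulrn -expiX expi2pi expr1n.
by rewrite NegzE mulrNz mulNr expiN -pmulrn -expiX expi2pi expr1n invr1.
Qed.

Lemma norm_expi (x : R) : `|expi x| = 1 :> C.
Proof. by rewrite /expi normc_def /= cos2Dsin2 sqrtr1. Qed.

Lemma unit_expi (z : C) : `|z| = 1 -> exists2 x : R, `|x| <= pi & z = expi x.
Proof.
case: z => a b; rewrite normc_def /= => /eqP.
rewrite eq_complex /= eqxx andbT => /eqP h.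
have {}h : a ^+ 2 + b ^+ 2 = 1.
  have := congr1 (fun u => u ^+ 2) h.
  by rewrite sqr_sqrtr ?expr1n // addr_ge0 ?sqr_ge0.
have a1 : -1 <= a <= 1.
  have := sqr_ge0 b; rewrite -lter_norml => b0.
  rewrite -(@ler_pXn2r _ 2) ?nnegrE // real_normK ?num_real // expr1n; lra.
have acp := acos_lepi a1; have ac0 := acos_ge0 a1.
have sb : sin (acos a) = `|b|.
  by rewrite sin_acos // -sqrtr_sqr; congr Num.sqrt; lra.
have [b0|b0] := leP 0 b.
  exists (acos a); first by rewrite ger0_norm.
  by rewrite /expi acosK ?in_itv //= sb ger0_norm.
exists (- acos a); first by rewrite normrN ger0_norm.
by rewrite /expi cosN sinN acosK ?in_itv //= sb ltr0_norm // opprK.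
Qed.

Lemma pi_le4 : pi <= 4 :> R.
Proof. by have := @pihalf_lt2 R; lra. Qed.

(** On [0, 1] by the mean value theorem, beyond 1 by monotonicity; the factor 1 / 2
accounts for pi / 2 <= 2. *)
Lemma sin_ge_lin (y : R) : 0 <= y <= pi / 2 -> cos 1 / 2 * y <= sin y.
Proof.
move=> /andP[y0 y2].
have p1 := @pihalf_ge1 R; have p2 := @pihalf_lt2 R; have c1 := @cos1_gt0 R.
have small (z : R) : 0 <= z <= 1 -> cos 1 * z <= sin z.
  move=> /andP[]; rewrite le_eqVlt => /predU1P[<-|z0 z1].
    by rewrite sin0 mulr0.
  have [|c] := @MVT R sin cos 0 z z0 (fun x _ => is_derive_sin x).
    exact/continuous_subspaceT/continuous_sin.
  rewrite in_itv /= => /andP[c0 cz]; rewrite sin0 !subr0 => ->.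
  rewrite ler_wpM2r ?(ltW z0) // ltW // ltr_cos ?in_itv /=; lra.
have [y1|y1] := leP y 1.
  apply: le_trans (small _ _); first by nra.
  by rewrite y0.
have s1 : cos 1 <= sin 1 :> R by have := small 1; rewrite mulr1; apply; lra.
have : sin 1 < sin y by rewrite ltr_sin ?in_itv /=; lra.
have : cos 1 / 2 * y <= cos 1 / 2 * 2 by apply: ler_wpM2l; lra.
lra.
Qed.

(** Turns the series of the 1 - cos theta_p in the definition of pretentiousness into
a bound for the series of the theta_p^2. *)
Lemma one_sub_cos_ge : exists2 c : R, 0 < c &
  forall x, `|x| <= pi -> c * x ^+ 2 <= 1 - cos x.
Proof.
have c1 := @cos1_gt0 R; exists (cos 1 ^+ 2 / 8).
  by rewrite divr_gt0 // exprn_gt0.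
move=> x xpi; rewrite -[cos x]cos_norm -(real_normK (num_real x)).
have x0 : 0 <= `|x| by [].
move: `|x| x0 xpi => y y0 yp.
have h : cos 1 / 2 * (y / 2) <= sin (y / 2) by apply: sin_ge_lin; lra.
have -> : 1 - cos y = 2 * sin (y / 2) ^+ 2.
  by rewrite {1}(_ : y = (y / 2) *+ 2) ?cos_mulr2n ?cos2sin2; lra.
have : (cos 1 / 2 * (y / 2)) ^+ 2 <= sin (y / 2) ^+ 2.
  have l0 : 0 <= cos 1 / 2 * (y / 2) by rewrite !mulr_ge0 ?invr_ge0 // ltW.
  by rewrite lerXn2r ?nnegrE //; apply: le_trans h.
by move: (cos 1) (sin _) => a b; lra.
Qed.

(** Closeness to 1 is measured by angles, so that the errors of products add up. *)
Definition near1 (e : R) (u : C) := exists2 x : R, `|x| <= e & u = expi x.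

Lemma near1M e d u v : near1 e u -> near1 d v -> near1 (e + d) (u * v).
Proof.
move=> [x xe ->] [y yd ->]; exists (x + y); last by rewrite expiD.
by apply: (le_trans (ler_normD _ _)); apply: lerD.
Qed.

Lemma near1V e u : near1 e u -> near1 e u^-1.
Proof. by move=> [x xe ->]; exists (- x); rewrite ?normrN ?expiN. Qed.

Lemma near1_le e d u : e <= d -> near1 e u -> near1 d u.
Proof. by move=> ed [x xe ->]; exists x => //; apply: le_trans ed. Qed.

Lemma near1_expi e x : `|x| <= e -> near1 e (expi x).
Proof. by exists x. Qed.

(** Pigeonhole principle: cut each circle into K equal arcs, of length at most e. *)
Lemma torus_recurrence (T : finType) (u : nat -> T -> R) (e : R) : 0 < e ->
  exists i j : nat, (i < j)%N /\ forall x, near1 e (expi (u j x - u i x)).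
Proof.
move=> e0; have pi0 := @pi_gt0 R.
pose tau : R := pi *+ 2; have tau0 : 0 < tau by rewrite /tau mulr2n addr_gt0.
pose K := (Num.bound (tau / e)).+1.
have Ke : tau / K%:R <= e.
  rewrite ler_pdivrMr ?ltr0n // mulrC -ler_pdivrMr // ltW //.
  apply: (lt_le_trans (archi_boundP _)); first by rewrite divr_ge0 ?ltW.
  by rewrite ler_nat.
pose fr (x : R) : R := x / tau - (Num.floor (x / tau))%:~R.
have fr0 x : 0 <= fr x by rewrite subr_ge0 floor_le.
have fr1 x : fr x < 1.
  by have := floorD1_gt (x / tau); rewrite /fr intrD; lra.
have frK x : (Num.truncn (fr x * K%:R)%R < K)%N.
  have h0 : 0 <= fr x * K%:R by rewrite mulr_ge0.
  rewrite -(@ltr_nat R) (@le_lt_trans _ _ (fr x * K%:R)) ?truncn_le //.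
  by rewrite gtr_pMl ?ltr0n.
pose cell n : {ffun T -> 'I_K} := [ffun x => Ordinal (frK (u n x))].
pose L := #|{ffun T -> 'I_K}|.
have [/injectiveP inj|] := boolP (injectiveb (fun n : 'I_L.+1 => cell n)).
  by have := leq_card _ inj; rewrite card_ord ltnn.
case/injectivePn => i [j ij hc].
wlog ij' : i j ij hc / (i < j)%N.
  move=> H; case: (ltngtP i j) => h; first exact: (H i j).
    by apply: (H j i) => //; rewrite eq_sym.
  by move: ij; rewrite (val_inj h) eqxx.
exists i, j; split=> // x.
have hx : Num.truncn (fr (u i x) * K%:R) = Num.truncn (fr (u j x) * K%:R).
  by move/ffunP/(_ x): hc; rewrite !ffunE => /(congr1 val).
exists (tau * (fr (u j x) - fr (u i x))).
  apply: le_trans Ke; rewrite normrM gtr0_norm // ler_pM2l //.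
  rewrite -[leRHS]mul1r ler_pdivlMr ?ltr0n //.
  rewrite -[X in _ * X](@normr_nat R) -normrM mulrBl.
  have h1 := truncn_itv (mulr_ge0 (fr0 (u i x)) (ler0n R K)).
  have h2 := truncn_itv (mulr_ge0 (fr0 (u j x)) (ler0n R K)).
  move: h1 h2; rewrite hx -natr1 ler_norml; lra.
have uE y : y = tau * fr y + (Num.floor (y / tau))%:~R * tau.
  by rewrite /fr; field; rewrite gt_eqF.
rewrite {1}(uE (u j x)) {1}(uE (u i x)) opprD addrACA expiD.
rewrite -mulrBr -mulrBl -intrB expi2piz mulr1 //.
Qed.

Lemma simultaneous_recurrence (T : finType) (alpha : T -> R) (e : R) : 0 < e ->
  exists2 M : nat, (0 < M)%N & forall x, near1 e (expi (M%:R * alpha x)).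
Proof.
move=> e0; have [i [j [ij h]]] := torus_recurrence (fun n x => n%:R * alpha x) e0.
exists (j - i)%N; first by rewrite subn_gt0.
by move=> x; have := h x; rewrite -mulrBl natrB // ltnW.
Qed.

End Circle.

(** * Pretentious functions *)

Section Pretentious.
Variable R : realType.
Local Notation C := R[i].

Lemma character1 q (chi : nat -> C) : dirichlet_character q chi -> chi 1%N = 1.
Proof.
move=> [_ _ chiM chi0].
have c1 : chi 1%N != 0 by apply/chi0; rewrite /coprime gcd1n.
by apply: (mulIf c1); rewrite mul1r -chiM mul1n.
Qed.

Lemma character_mod q (chi : nat -> C) m n : dirichlet_character q chi ->
  m = n %[mod q] -> chi m = chi n.
Proof.
move=> [_ chiq _ _] mn.
have h k a : chi (a + k * q)%N = chi a.
  by elim: k => [|k IH]; rewrite ?mul0n ?addn0 // mulSn addnCA addnC chiq.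
by rewrite (divn_eq m q) (divn_eq n q) mn addnC h addnC h.
Qed.

Lemma characterX q (chi : nat -> C) n k : dirichlet_character q chi ->
  chi (n ^ k)%N = chi n ^+ k.
Proof.
move=> H; have [_ _ chiM _] := H.
elim: k => [|k IH]; first by rewrite expn0 expr0 (character1 H).
by rewrite expnS exprS chiM IH.
Qed.

(** The values are roots of unity, by Euler's theorem. *)
Lemma norm_character q (chi : nat -> C) n : dirichlet_character q chi ->
  coprime n q -> `|chi n| = 1.
Proof.
move=> H cn; have [q0 _ _ _] := H.
apply/eqP; rewrite -(@pexpr_eq1 _ _ (totient q)) ?totient_gt0 // -normrX.
rewrite -(characterX _ _ H) (character_mod H (Euler_exp_totient cn)).
by rewrite (character1 H) normr1.
Qed.

Lemma Re_le_norm1 (z : C) : `|z| <= 1 -> complex.Re z <= 1.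
Proof.
case: z => a b; rewrite normc_def lecE /= => /andP[_ h].
have := ler_norm a; have : `|a| <= Num.sqrt (a ^+ 2 + b ^+ 2).
  by rewrite -sqrtr_sqr ler_wsqrtr // lerDl sqr_ge0.
lra.
Qed.

Lemma Re_expi (x : R) : complex.Re (expi x) = cos x.
Proof. by []. Qed.

Lemma nat_pow_itM (m n : nat) (t : R) : (0 < m)%N -> (0 < n)%N ->
  nat_pow_it (m * n) t = nat_pow_it m t * nat_pow_it n t.
Proof.
move=> m0 n0; rewrite /nat_pow_it natrM lnM ?posrE ?ltr0n //.
by rewrite mulrDr expiD.
Qed.

(** The predicate P allows for the finitely many primes at which nothing is known
about the function. *)
Lemma multiplicative_angles (H : nat -> C) (P : pred nat) (theta : nat -> R) :
  H 1%N = 1 ->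
  (forall m n, (0 < m)%N -> (0 < n)%N -> H (m * n)%N = H m * H n) ->
  (forall p, prime p -> P p -> H p = expi (theta p)) ->
  forall g, (0 < g)%N -> (forall p, prime p -> (p %| g)%N -> P p) ->
  H g = expi (additive_ext theta g).
Proof.
move=> H1 HM Hp g g0 hP.
have HX p k : (0 < p)%N -> H (p ^ k)%N = H p ^+ k.
  move=> p0; elim: k => [|k IH]; first by rewrite expn0 expr0.
  by rewrite expnS exprS HM ?expn_gt0 ?p0 // IH.
have sP : forall p, p \in primes g -> prime p && P p.
  by move=> p; rewrite mem_primes g0 /= => /andP[pp pg]; rewrite pp hP.
rewrite {1}(prod_primes_logn g0) /additive_ext.
elim: (primes g) sP => [|p s IH] sP; first by rewrite !big_nil expi0.
have /andP[pp Pp] : prime p && P p by apply: sP; rewrite mem_head.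
have {}IH := IH (fun x xs => sP x (mem_behead (s := p :: s) xs)).
have s0 : (0 < \prod_(r <- s) r ^ logn r g)%N.
  rewrite big_seq; apply: prodn_cond_gt0 => r rs.
  have /andP[pr _] := sP r (mem_behead (s := p :: s) rs).
  by rewrite expn_gt0 prime_gt0.
have p0 := prime_gt0 pp.
rewrite !big_cons expiD -IH HM ?expn_gt0 ?p0 //.
by rewrite HX // Hp // expiX.
Qed.

Lemma sum_primes_in w P (u : nat -> R) :
  \sum_(p <- primes_in w P) u p = \sum_(w.+1 <= p < P.+1 | prime p) u p.
Proof. by rewrite big_filter. Qed.

Lemma summable_tails (u : nat -> R) : (forall p, prime p -> 0 <= u p) ->
  (\sum_(0 <= p <oo | prime p) (u p)%:E < +oo :> \bar R)%E ->
  forall e : R, 0 < e -> exists w0 : nat, forall w P : nat, (w0 <= w)%N ->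
    \sum_(p <- primes_in w P) u p <= e.
Proof.
move=> u0 hs e e0.
have u0E k : prime k -> (0 <= (u k)%:E)%E by move=> pk; rewrite lee_fin u0.
have := nneseries_tail_cvg hs u0E.
move=> /fine_cvgP[hfin /cvgrPdist_le /(_ e e0) hdist].
have [w0 _ hw0] : (\forall n \near \oo,
    (\sum_(n <= k <oo | prime k) (u k)%:E)%E \is a fin_num /\
    `|0 - fine (\sum_(n <= k <oo | prime k) (u k)%:E)%E| <= e)%classic.
  by near=> n; split; near: n.
exists w0 => w P ww; rewrite sum_primes_in.
have [wfin wd] := hw0 w.+1 (leqW ww).
rewrite -lee_fin -sumEFin.
apply: (le_trans (@nneseries_lim_ge R _ prime w.+1 P.+1 _)).
  by move=> k _; apply: u0E.
rewrite -(fineK wfin) lee_fin; apply: le_trans wd.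
by rewrite sub0r normrN ler_norm.
Unshelve. all: by end_near.
Qed.

(** Only integers congruent to 1 modulo q are considered, so that the character
disappears. *)
Definition pretentious_data (f : nat -> C) (q : nat) (t : R) (theta : nat -> R) :=
  [/\ (0 < q)%N, forall p, `|theta p| <= 4, prime_tails_vanish theta &
     forall g, (0 < g)%N -> g = 1 %[mod q] ->
       f g = expi (t * ln g%:R) * expi (additive_ext theta g)].

(** The angles theta are those of the twist of f by the conjugate character and
by n^(-it); at the primes dividing the modulus they are set to 0. *)
Lemma pretentious_structure (f : nat -> C) :
  (forall n, (0 < n)%N -> unit_circle (f n)) -> completely_multiplicative f ->
  pretentious f ->
  exists (q : nat) (t : R) (theta : nat -> R), pretentious_data f q t theta.
Proof.
move=> f1 fM [q [chi [t [Hchi hs]]]].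
have [q0 _ chiM chi0] := Hchi.
pose H n := f n * (chi n)^* * nat_pow_it n (- t).
have chi_norm n : `|chi n| <= 1.
  have [cn|cn] := boolP (coprime n q); first by rewrite (norm_character Hchi cn).
  have [->|/chi0 cn'] := eqVneq (chi n) 0; first by rewrite normr0 ler01.
  by rewrite cn' in cn.
have normH n : (0 < n)%N -> `|H n| = `|chi n|.
  move=> n0; rewrite /H !normrM (f1 n n0) mul1r norm_conjC.
  by rewrite /nat_pow_it norm_expi mulr1.
have [c c0 hc] := one_sub_cos_ge R.
have : forall p, exists x : R, [/\ `|x| <= pi,
    prime p -> coprime p q -> H p = expi x &
    prime p -> c * x ^+ 2 <= 1 - complex.Re (H p)].
  move=> p; have [pp|pp] := boolP (prime p); last first.
    by exists 0; split=> //; rewrite normr0 pi_ge0.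
  have p0 := prime_gt0 pp.
  have [cp|cp] := boolP (coprime p q).
    have : `|H p| = 1 by rewrite normH // (norm_character Hchi cp).
    case/unit_expi => x xpi hx; exists x; split=> // _.
    by rewrite hx Re_expi hc.
  exists 0; split=> // [|_]; first by rewrite normr0 pi_ge0.
  rewrite expr0n mulr0 subr_ge0; apply: Re_le_norm1.
  by rewrite normH.
case/boolp.choice => theta htheta.
exists q, t, theta; split=> //.
- by move=> p; have [h _ _] := htheta p; apply: le_trans h _; apply: pi_le4.
- move=> e e0.
  pose u p : R := p%:R^-1 * (1 - complex.Re (H p)).
  have u0 p : prime p -> 0 <= u p.
    move=> pp; rewrite mulr_ge0 ?invr_ge0 // subr_ge0 Re_le_norm1 // normH //.
    exact: prime_gt0.
  have [w0 hw0] := summable_tails u0 hs (mulr_gt0 c0 e0).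
  exists w0 => w P ww; have h0 := hw0 w P ww.
  rewrite -(ler_pM2l c0); apply: le_trans h0; rewrite mulr_sumr.
  rewrite big_seq [leRHS]big_seq; apply: ler_sum => p.
  rewrite mem_primes_in => /and3P[pp _ _]; have [_ _ /(_ pp) h] := htheta p.
  by rewrite mulrA mulrC /u ler_wpM2l // invr_ge0.
- move=> g g0 gq.
  have cg : coprime g q.
    by rewrite /coprime -gcdn_modl gq gcdn_modl gcd1n.
  have chig : chi g = 1 by rewrite (character_mod Hchi gq) (character1 Hchi).
  have H1 : H 1%N = 1.
    have f11 : f 1%N = 1.
      have n1 : f 1%N != 0.
        by rewrite -normr_gt0 (f1 1%N isT) ltr01.
      by apply: (mulIf n1); rewrite mul1r -fM // mul1n.
    by rewrite /H f11 (character1 Hchi) conjC1 /nat_pow_it ln1 mulr0 expi0 !mulr1.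
  have HM m n : (0 < m)%N -> (0 < n)%N -> H (m * n)%N = H m * H n.
    move=> m0 n0; rewrite /H fM // chiM rmorphM nat_pow_itM //=; ring.
  have := @multiplicative_angles H (fun p => coprime p q) theta H1 HM _ g g0 _.
  move=> <-.
  + rewrite /H chig conjC1 mulr1 /nat_pow_it mulrCA -expiD mulNr subrr expi0.
    by rewrite mulr1.
  + by move=> p pp cp; have [_ h _] := htheta p; apply: h.
  + by move=> p pp pg; apply: coprime_dvdl cg.
Qed.
End Pretentious.

(** * Archimedean estimates *)

Section Archimedean.
Variable R : realType.

Lemma norm_ln_le (r d : R) : `|r - 1| <= d -> d <= 1 / 2 -> `|ln r| <= 2 * d.
Proof.
rewrite ler_distl => /andP[r1 r2] d2.
have r0 : 0 < r by lra.
have h1 : ln r <= r - 1.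
  by have := @le_ln1Dx R (r - 1); rewrite addrCA subrr addr0; apply; lra.
have h2 : - ln r <= r^-1 - 1.
  rewrite -lnV ?posrE //; have := @le_ln1Dx R (r^-1 - 1).
  rewrite addrCA subrr addr0; apply; have : 0 < r^-1 by rewrite invr_gt0.
  lra.
have h3 : r^-1 - 1 <= 2 * d.
  rewrite lerBlDr -[leLHS]mul1r ler_pdivrMr //.
  by nra.
by rewrite ler_norml; apply/andP; split; lra.
Qed.

(** When n is small compared with m the form is dominated by m^2. *)
Lemma monic_form_near_square (b c : int) (m n : nat) (eta : R) : (0 < m)%N ->
  n%:R <= eta * m%:R -> eta <= 1 ->
  let S := (`|b| + `|c|)%N in S%:R * eta <= 1 / 2 ->
  [/\ 0 < qform (1%R, b, c) m%:Z n%:Z,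
      (`|qform (1%R, b, c) m%:Z n%:Z| <= 2 * m ^ 2)%N
    & `|ln `|qform (1%R, b, c) m%:Z n%:Z|%N%:R - 2 * ln m%:R| <= 2 * (S%:R * eta)].
Proof.
move=> m0 hn eta1 S hS.
have mR : (0 : R) < m%:R by rewrite ltr0n.
have eta0 : 0 <= eta.
  by rewrite -(pmulr_lge0 _ mR); apply: le_trans hn.
set G := qform _ _ _; set g : R := G%:~R.
have gE : g = m%:R ^+ 2 + b%:~R * m%:R * n%:R + c%:~R * n%:R ^+ 2.
  by rewrite /g /G /qform /= mul1r !expr2 !intrD !intrM.
have hr : `|g / m%:R ^+ 2 - 1| <= S%:R * eta.
  have -> : g / m%:R ^+ 2 - 1 = b%:~R * (n%:R / m%:R) + c%:~R * (n%:R / m%:R) ^+ 2.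
    by rewrite gE; field; rewrite gt_eqF.
  have x0 : 0 <= n%:R / m%:R :> R by rewrite divr_ge0.
  have x1 : n%:R / m%:R <= eta by rewrite ler_pdivrMr.
  move: (n%:R / m%:R) x0 x1 => x x0 x1.
  rewrite /S natrD mulrDl; apply: (le_trans (ler_normD _ _)).
  have nz (z : int) : `|z|%N%:R = `|z%:~R| :> R by rewrite -intr_norm -abszE -pmulrn.
  rewrite !nz !normrM; apply: lerD; apply: ler_pM => //; rewrite ?normrX ger0_norm //.
  by nra.
have gm : 0 < g / m%:R ^+ 2.
  by move: hr; rewrite ler_distl => /andP[h _]; lra.
have m2 : (0 : R) < m%:R ^+ 2 by rewrite exprn_gt0.
have g0 : 0 < g by rewrite -(pmulr_lgt0 _ (_ : 0 < (m%:R ^+ 2)^-1)) ?invr_gt0.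
have G0 : 0 < G by rewrite -(ltr0z R).
have GE : `|G|%N%:R = g by rewrite /g -[in RHS](gtz0_abs G0) -pmulrn.
split=> //.
  rewrite -(ler_nat R) GE natrM natrX; move: hr; rewrite ler_distl => /andP[_ h].
  by rewrite -ler_pdivrMr //; lra.
rewrite GE [2 * ln _]mulr_natl -lnXn // -ln_div ?posrE //.
exact: norm_ln_le.
Qed.

Lemma ln_ratio_le (m n' K T : nat) : (0 < m)%N -> (0 < n')%N -> (0 < K)%N ->
  (1 < T)%N -> (T * m <= T.+1 * (K * n'))%N -> (T * (K * n') <= T.+1 * m)%N ->
  `|ln m%:R - ln n'%:R - ln K%:R| <= 2 / T%:R :> R.
Proof.
move=> m0 n0 K0 T1 h1 h2.
have mR : (0 : R) < m%:R by rewrite ltr0n.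
have nR : (0 : R) < n'%:R by rewrite ltr0n.
have KR : (0 : R) < K%:R by rewrite ltr0n.
have TR : (1 : R) < T%:R by rewrite ltr1n.
have T2 : (2 : R) <= T%:R by rewrite ler_nat.
have T0 : (0 : R) < T%:R by lra.
rewrite -ln_div ?posrE // -ln_div ?posrE ?divr_gt0 //.
apply: norm_ln_le; last by rewrite -[leLHS]mul1r ler_pdivrMr //; lra.
have KN : (0 : R) < K%:R * n'%:R by rewrite mulr_gt0.
have -> : m%:R / n'%:R / K%:R = m%:R / (K%:R * n'%:R) :> R.
  by field; rewrite !gt_eqF.
move: h1 h2; rewrite -!(ler_nat R) !natrM -!natr1.
set y := K%:R * n'%:R in KN * => h1 h2.
rewrite ler_distl; apply/andP; split.
  rewrite ler_pdivlMr // -(ler_pM2l T0) mulrA mulrBr mulfV ?gt_eqF // mulr1.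
  nra.
rewrite ler_pdivrMr // -(ler_pM2l T0) mulrA mulrDr mulfV ?gt_eqF // mulr1.
lra.
Qed.

(** The box starts at distance T N from the origin, T times its side, so
the ratio of the two coordinates is K up to a factor 1 + 1 / T. *)
Lemma box_ratio (Q K T N i j : nat) : (0 < Q)%N -> (0 < K)%N ->
  (i < N)%N -> (j < N)%N ->
  let m := (1 + Q * (K * T * N + i))%N in let n' := (1 + Q * (T * N + j))%N in
  [/\ (T * m <= T.+1 * (K * n'))%N, (T * (K * n') <= T.+1 * m)%N
    & (m <= Q * ((K * T).+1 * N))%N].
Proof.
move=> Q0 K0 iN jN m n'.
have i1 : (1 + Q * i <= Q * N)%N.
  by apply: (@leq_trans (Q * i.+1)); rewrite ?leq_mul2l ?iN ?orbT // mulnS leq_add2r.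
have j1 : (1 + Q * j <= Q * N)%N.
  by apply: (@leq_trans (Q * j.+1)); rewrite ?leq_mul2l ?jN ?orbT // mulnS leq_add2r.
have mu : (m <= Q * ((K * T).+1 * N))%N.
  by rewrite /m mulnDr addnCA mulSn addnC mulnDr leq_add2r.
have ml : (Q * (K * T * N) <= m)%N by rewrite /m mulnDr addnCA leq_addr.
have nu : (n' <= Q * (T * N + N))%N.
  by rewrite /n' mulnDr addnCA mulnDr leq_add2l.
have nl : (Q * (T * N) <= n')%N by rewrite /n' mulnDr addnCA leq_addr.
split=> //.
  apply: (@leq_trans (T * (Q * ((K * T).+1 * N)))); first by rewrite leq_mul2l mu orbT.
  apply: (@leq_trans (T.+1 * (K * (Q * (T * N))))); last by rewrite !leq_mul2l nl !orbT.
  move: (Q * N)%N (erefl (Q * N)%N) => X XE.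
  rewrite (_ : T * _ = K * T * T * (Q * N) + T * (Q * N))%N; last by ring.
  rewrite (_ : T.+1 * _ = K * T * T * (Q * N) + K * (T * (Q * N)))%N; last by ring.
  by rewrite leq_add2l leq_pmull.
apply: (@leq_trans (T * (K * (Q * (T * N + N))))); first by rewrite !leq_mul2l nu !orbT.
apply: (@leq_trans (T.+1 * (Q * (K * T * N)))); last by rewrite leq_mul2l ml orbT.
by apply: eq_leq; ring.
Qed.

End Archimedean.

(** * Aligned values of forms *)

Section Aligned.
Variable R : realType.
Local Notation C := R[i].

(** The value of f at g compared with its predicted value, where g is the form
up to a factor without large primes: an error 2 kappa comes from n^(it), kappa from
the deviation from the mean, and 12 kappa from the at most 12 primes exceeding P. *)
Lemma value_angle (f : nat -> C) q t theta (F : int * int * int) (g m n w P : nat)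
    (kappa : R) :
  pretentious_data f q t theta -> (0 < g)%N -> g = 1 %[mod q] -> 0 <= kappa ->
  (forall p e, prime p -> (w < p)%N ->
     ((p ^ e)%N%:Z %| qform F m%:Z n%:Z)%Z = (p ^ e %| g)%N) ->
  (forall p, prime p -> (p %| g)%N -> (w < p)%N) ->
  (0 < P)%N -> (w <= P)%N -> (g < P ^ 13)%N ->
  (forall p, prime p -> (w < p)%N -> (p <= P)%N ->
     ~~ ((p ^ 2)%N%:Z %| qform F m%:Z n%:Z)%Z) ->
  `|\sum_(p <- primes_in w P) theta p * zero_ind R F p m n
     - (drift F theta P - drift F theta w)| <= kappa ->
  (forall p, prime p -> (P < p)%N -> (p%:Z %| qform F m%:Z n%:Z)%Z ->
     `|theta p| <= kappa) ->
  near1 (2 * kappa) (expi (t * (ln g%:R - 2 * ln m%:R))) ->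
  near1 (15 * kappa) (f g / (expi (t * (2 * ln m%:R))
     * expi (drift F theta P - drift F theta w))).
Proof.
move=> [q0 _ _ fE] g0 gq kap0 hFg hw P0 wP gP hsq hsum hlarge harch.
have -> : f g / (expi (t * (2 * ln m%:R)) * expi (drift F theta P - drift F theta w))
   = expi (t * (ln g%:R - 2 * ln m%:R))
     * expi (additive_ext theta g - (drift F theta P - drift F theta w)).
  rewrite (fE g g0 gq) -!expiD -expiN -!expiD; congr expi; ring.
rewrite (_ : 15 * kappa = 2 * kappa + 13 * kappa); last by ring.
apply: near1M => //; apply: near1_expi.
have hFg1 p : prime p -> (w < p)%N -> (p%:Z %| qform F m%:Z n%:Z)%Z = (p %| g)%N.
  by move=> pp wp; have := hFg p 1%N pp wp; rewrite expn1.
have := @additive_ext_close R theta g w P 12 kappa g0 P0 wP gP kap0 hw.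
have -> : \sum_(p <- primes_in w P) theta p * (p %| g)%N%:R
    = \sum_(p <- primes_in w P) theta p * zero_ind R F p m n.
  rewrite big_seq [RHS]big_seq; apply: eq_bigr => p.
  by rewrite mem_primes_in => /and3P[pp wp _]; rewrite /zero_ind hFg1.
move=> h; have {}h : `|additive_ext theta g
     - \sum_(p <- primes_in w P) theta p * zero_ind R F p m n| <= 12 * kappa.
  apply: h => [p pp wp pP|p pp Pp pg]; first by rewrite -hFg // hsq.
  by apply: hlarge; rewrite ?hFg1 // (leq_ltn_trans wP).
apply: (le_trans (ler_distD (\sum_(p <- primes_in w P) theta p * zero_ind R F p m n) _ _)).
by lra.
Qed.

(** The form m n, with index None, is treated along with the monic ones; its
value is taken with the factor B. *)
Definition aligned_form (K : finType) (be ga : K -> int) (o : option K) : int * int * int :=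
  if o is Some k then (1%R, be k, ga k) else (0%R, 1%R, 0%R).

Definition aligned_value (K : finType) (be ga : K -> int) (B : nat) (o : option K)
    (m n : nat) : nat :=
  if o is Some k then `|qform (1%R, be k, ga k) m%:Z n%:Z|%N else (B * (m * n))%N.

Lemma prime_dvd_fact (p w : nat) : prime p -> (p %| w`!)%N = (p <= w)%N.
Proof.
move=> pp; apply/idP/idP => [|pw]; last by rewrite dvdn_fact // prime_gt0.
elim: w => [|w IH]; first by rewrite fact0 dvdn1 => /eqP p1; rewrite p1 in pp.
by rewrite factS Euclid_dvdM // => /orP[/dvdn_leq -> //|/IH/leqW].
Qed.

Lemma congr1_consequences (Q q g w : nat) : (q %| Q)%N ->
  (forall p, prime p -> (p <= w)%N -> (p %| Q)%N) ->
  (Q%:Z %| g%:Z - 1)%Z ->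
  g = 1 %[mod q] /\ (forall p, prime p -> (p %| g)%N -> (w < p)%N).
Proof.
move=> qQ hQ hg; split.
  have : (q%:Z %| g%:Z - 1)%Z by apply: dvdz_trans hg; rewrite dvdzE.
  by rewrite -eqz_mod_dvd !modz_nat => /eqP[].
move=> p pp pg; rewrite ltnNge; apply/negP => /(hQ p pp) pQ.
have h1 : (p%:Z %| g%:Z - 1)%Z by apply: dvdz_trans hg; rewrite dvdzE.
have : (p%:Z %| g%:Z - (g%:Z - 1))%Z by apply: rpredB => //; rewrite dvdzE.
by rewrite opprB addrC subrK dvdzE /= dvdn1 => /eqP p1; rewrite p1 in pp.
Qed.

(** The choice of the progressions. The predicted value depends on the form only
through the increment of the drift. *)
Lemma progression_sampling (s : nat) (f : 'I_s -> nat -> C) (q : 'I_s -> nat)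
    (t : 'I_s -> R) (theta : 'I_s -> nat -> R) (K : finType) (be ga : K -> int)
    (B L : nat) (kappa : R) :
  (forall j n, (0 < n)%N -> unit_circle (f j n)) ->
  (forall j, completely_multiplicative (f j)) ->
  (forall j, pretentious_data (f j) (q j) (t j) (theta j)) ->
  (forall k, be k ^+ 2 - 4 * ga k != 0) -> (0 < B)%N -> 0 < kappa ->
  exists w1, forall w, (w1 <= w)%N -> exists P0, forall P, (P0 <= P)%N ->
  exists m n : nat, [/\ (0 < m)%N, (0 < n)%N, (L * n <= m)%N
    & forall o, (if o is Some k then 0 < qform (1%R, be k, ga k) m%:Z n%:Z else true)
      /\ forall j, near1 (16 * kappa) (f j (aligned_value be ga B o m n)
        / (expi (t j * (2 * ln m%:R))
           * expi (drift (aligned_form be ga o) (theta j) P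
                   - drift (aligned_form be ga o) (theta j) w)))].
Proof.
move=> f1 fM hf D0 B0 kap0.
pose J := ('I_s * option K)%type.
pose Fo (x : J) := aligned_form be ga x.2.
have FoD x : qdisc (Fo x) != 0.
  case: x => j [k|] /=; rewrite /qdisc /=; last by [].
  by rewrite mulr1.
have th4 (x : J) p : `|theta x.1 p| <= 4 by have [_ h _ _] := hf x.1.
have tails (x : J) : prime_tails_vanish (theta x.1) by have [_ _ h _] := hf x.1.
have [w0 hw0] := @sample_point R J Fo (fun x => theta x.1) FoD th4 tails kappa kap0.
pose qq := (\prod_j q j)%N.
have qq0 : (0 < qq)%N by apply: prodn_gt0 => j; have [] := hf j.
pose tt : R := 1 + \sum_j `|t j|.
have tt1 : 1 <= tt by rewrite lerDl sumr_ge0.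
have ttj j : `|t j| <= tt.
  by rewrite /tt (bigD1 j) //= addrCA lerDl addr_ge0 ?ler01 // sumr_ge0.
pose S := (\sum_k (`|be k| + `|ga k|)%N)%N.
have SS k : (`|be k| + `|ga k| <= S)%N by rewrite /S (bigD1 k) //= leq_addr.
have [T [T1 hT]] : exists T : nat, (1 < T)%N /\ tt * (2 / T%:R) <= kappa.
  have [T0 hT0] := archi_inv (tt * 2) kap0.
  exists (maxn T0 2); split; first by rewrite leq_max orbT.
  by rewrite mulrA; apply: (hT0 _ (leq_maxl _ _)).2.
exists (maxn (maxn w0 qq) (maxn B 2)) => w.
rewrite !geq_max => /andP[/andP[w0w qw] /andP[Bw w2]].
pose Q := w`!.
have Q0 : (0 < Q)%N by apply: fact_gt0.
have qQ j : (q j %| Q)%N.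
  apply: (@dvdn_trans qq); last by rewrite dvdn_fact // qq0.
  by rewrite /qq (bigD1 j) //= dvdn_mulr.
have pQ p : prime p -> (w < p)%N -> ~~ (p %| Q)%N.
  by move=> pp wp; rewrite prime_dvd_fact // -ltnNge.
have BQ0 : (0 < B * Q)%N by rewrite muln_gt0 B0.
(* n0 is such that B n0 is a power of B Q at which every f j is close to 1 *)
have [M M0 hM] : exists2 M, (0 < M)%N & forall j, near1 kappa (f j (B * Q)%N ^+ M).
  have /boolp.choice[al hal] : forall j, exists x, f j (B * Q)%N = expi x.
    by move=> j; have [x _ ->] := unit_expi (f1 j _ BQ0); exists x.
  have [M M0 hM] := simultaneous_recurrence al kap0.
  by exists M => // j; rewrite hal expiX.
pose n0 := (B ^ M.-1 * Q ^ M)%N.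
have Bn0 : (B * n0 = (B * Q) ^ M)%N.
  by rewrite /n0 mulnA -expnS prednK // expnMn.
have n00 : (0 < n0)%N by rewrite muln_gt0 !expn_gt0 B0 Q0.
have Qn0 : (Q %| n0)%N.
  by rewrite /n0 -(prednK M0) expnS mulnCA dvdn_mulr.
have pn0 p : prime p -> (w < p)%N -> ~~ (p %| n0)%N.
  move=> pp wp; rewrite Euclid_dvdM // !Euclid_dvdX // (negPf (pQ p pp wp)) /=.
  by rewrite orbF negb_and gtnNdvd // (leq_ltn_trans Bw).
have fX j k x : (0 < x)%N -> f j (x ^ k.+1)%N = f j x ^+ k.+1.
  move=> x0; elim: k => [|k IH]; first by rewrite expn1 expr1.
  by rewrite expnS exprS fM ?expn_gt0 ?x0 // IH.
have fBn0 j : near1 kappa (f j (B * n0)%N).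
  by rewrite Bn0 -(prednK M0) fX // prednK.
(* m will be about k0 times n / n0, for a power k0 of b: any such power is large
   enough, and some power makes k0 ^ (i t_j) close to 1 *)
have [b [b1 bL beta]] : exists b : nat, [/\ (1 < b)%N, (2 * (L * n0) <= b)%N &
    (tt * (2 * S.+1%:R)) * (2 * n0%:R) / b%:R <= Num.min kappa (1 / 2)].
  have mk0 : 0 < Num.min kappa (1 / 2) by rewrite lt_min kap0 /=; lra.
  have [c hc] := archi_inv (tt * (2 * S.+1%:R) * (2 * n0%:R)) mk0.
  exists (maxn c (maxn 2 (2 * (L * n0)))); split.
  - by rewrite !leq_max orbT.
  - by rewrite !leq_max leqnn !orbT.
  - by apply: (hc _ (leq_maxl _ _)).2.
have [M' M'0 hM'] := simultaneous_recurrence (fun j => t j * ln b%:R) kap0.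
pose k0 := (b ^ M')%N.
have k00 : (0 < k0)%N by rewrite expn_gt0 (ltnW b1).
have bk0 : (b <= k0)%N by rewrite /k0 -(prednK M'0) expnS leq_pmulr // expn_gt0 (ltnW b1).
have fk0 j : near1 kappa (expi (t j * ln k0%:R)).
  rewrite /k0 natrX lnXn ?ltr0n ?(ltnW b1) // -[ln _ *+ _]mulr_natl mulrCA; exact: hM'.
have hB p : prime p -> (w < p)%N -> ~~ (p %| Q)%N && ~~ (p %| n0 * Q)%N.
  by move=> pp wp; rewrite pQ //= Euclid_dvdM // negb_or pn0 ?pQ.
have n0Q0 : (0 < n0 * Q)%N by rewrite muln_gt0 n00.
have [P1 hP1] := hw0 w w0w 1%N Q n0 (n0 * Q)%N (k0 * T)%N Q0 n0Q0 hB.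
(* the values are at most C1 N^2 = C1 P^12, hence less than P^13 *)
pose C1 := (2 * (Q * (k0 * T).+1) ^ 2)%N.
exists (maxn (maxn P1 w) C1.+1) => P.
rewrite !geq_max => /andP[/andP[P1P wP] C1P].
have P0 : (0 < P)%N by apply: leq_trans C1P.
set N := (P ^ 6)%N.
pose m i := (1 + Q * (k0 * T * N + i))%N.
pose n' j := (1 + Q * (T * N + j))%N.
have nE j : (n0 + n0 * Q * (T * N + j) = n0 * n' j)%N.
  by rewrite /n' [RHS]mulnDr muln1 mulnA.
pose eta : R := 2 * n0%:R / b%:R.
have bR : (0 : R) < b%:R by rewrite ltr0n ltnW.
have eta0 : 0 <= eta by rewrite divr_ge0 ?mulr_ge0.
have hbeta : tt * (2 * S.+1%:R) * eta <= Num.min kappa (1 / 2).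
  by move: beta; rewrite -[X in X <= _]mulrA.
have Seta k : (`|be k| + `|ga k|)%N%:R * eta <= S.+1%:R * eta.
  by rewrite ler_wpM2r // ler_nat leqW.
have hSeta : S.+1%:R * eta <= 1 / 2 /\ eta <= 1 /\ tt * (2 * (S.+1%:R * eta)) <= kappa.
  move: hbeta; rewrite le_min => /andP[hb1 hb2].
  have s1 : (1 : R) <= S.+1%:R by rewrite ler1n.
  have h1 : 0 <= S.+1%:R * eta by rewrite mulr_ge0.
  have h2 : eta <= S.+1%:R * eta by rewrite ler_peMl.
  have h3 : 2 * (S.+1%:R * eta) <= tt * (2 * S.+1%:R) * eta.
    by rewrite -[tt * _ * _]mulrA -[2 * _ * eta]mulrA ler_peMl // mulr_ge0.
  have h4 : tt * (2 * S.+1%:R) * eta = tt * (2 * (S.+1%:R * eta)) by ring.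
  by rewrite -h4; split; [|split]; lra.
have [Seta1 [eta1 tSeta]] := hSeta.
have pt i j : (i < N)%N -> (j < N)%N ->
   [/\ (n' j <= m i)%N, (L * (n0 * n' j) <= m i)%N, (m i <= Q * ((k0 * T).+1 * N))%N,
      (n0 * n' j)%N%:R <= eta * (m i)%:R
    & `|ln (m i)%:R - ln (n' j)%:R - ln k0%:R| <= 2 / T%:R :> R].
  move=> iN jN.
  have [r1 r2 r3] := box_ratio T Q0 k00 iN jN; rewrite -/(m i) -/(n' j) in r1 r2 r3.
  have k0n : (k0 * n' j <= 2 * m i)%N.
    rewrite -(@leq_pmul2l T) ?(ltnW T1) //; apply: (leq_trans r2).
    by rewrite mulnA leq_mul2r muln2 -addnn -addn1 leq_add2l (ltnW T1) orbT.
  have nb : (b * n' j <= 2 * m i)%N.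
    by apply: leq_trans k0n; rewrite leq_mul2r bk0 orbT.
  split=> //.
  - by rewrite -(@leq_pmul2l 2) // (leq_trans _ nb) // leq_mul2r b1 orbT.
  - have e2 : (2 * (L * (n0 * n' j)) = 2 * (L * n0) * n' j)%N by rewrite !mulnA.
    rewrite -(@leq_pmul2l 2) // e2 (leq_trans _ nb) //.
    by rewrite leq_mul2r bL orbT.
  - have e1 : (n0 * n' j * b = n0 * (b * n' j))%N by rewrite -mulnA (mulnC _ b).
    have e2 : (2 * n0 * m i = n0 * (2 * m i))%N by rewrite (mulnC 2) mulnA.
    rewrite /eta mulrAC ler_pdivlMr // -!natrM ler_nat e1 e2.
    by rewrite leq_mul2l nb orbT.
  - by apply: ln_ratio_le.
have N0 : (0 < N)%N by rewrite expn_gt0 P0.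
have m_gt0 i : (0 < m i)%N by [].
have n_gt0 j : (0 < n0 * n' j)%N by rewrite muln_gt0 n00.
have form_pos i j k : (i < N)%N -> (j < N)%N ->
    [/\ 0 < qform (1%R, be k, ga k) (m i)%:Z (n0 * n' j)%N%:Z,
       (`|qform (1%R, be k, ga k) (m i)%:Z (n0 * n' j)%N%:Z| <= 2 * m i ^ 2)%N
     & `|ln `|qform (1%R, be k, ga k) (m i)%:Z (n0 * n' j)%N%:Z|%N%:R
         - 2 * ln (m i)%:R| <= 2 * (S.+1%:R * eta)].
  move=> iN jN; have [_ _ _ hn _] := pt i j iN jN.
  have [] := @monic_form_near_square R (be k) (ga k) _ _ _ (m_gt0 i) hn eta1.
    exact: le_trans (Seta k) Seta1.
  move=> h1 h2 h3; split=> //; apply: (le_trans h3).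
  by rewrite ler_wpM2l.
have [|||i [j [iN jN hx]]] := hP1 P P1P (k0 * T * N)%N (T * N)%N.
- by [].
- by rewrite -mulnA leq_pmull.
- move=> i j [j' o] iN jN; rewrite !nE -/(m i); split; first exact: n_gt0.
  case: o => [k|]; first by rewrite gt_eqF //; have [] := form_pos i j k iN jN.
  rewrite /Fo /qform /= mul0r add0r mul1r mul0r addr0 -PoszM.
  by rewrite eqz_nat -lt0n muln_gt0 n_gt0.
exists (m i), (n0 * n' j)%N.
have [nm Lm mN hn hln] := pt i j iN jN.
split=> // o; split; first by case: o => [k|] //; have [] := form_pos i j k iN jN.
move=> j'; have := hx (j', o); rewrite /= nE -/(m i) => -[s1 s2 s3].
have hQw p : prime p -> (p <= w)%N -> (p %| Q)%N.
  by move=> pp pw; rewrite prime_dvd_fact.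
have Qm : (Q%:Z %| (m i)%:Z - 1)%Z.
  by rewrite /m PoszD addrC addKr PoszM dvdz_mulr.
have Qn' : (Q%:Z %| (n' j)%:Z - 1)%Z.
  by rewrite /n' PoszD addrC addKr PoszM dvdz_mulr.
have gP (g : nat) : (g <= 2 * m i ^ 2)%N -> (g < P ^ 13)%N.
  move=> hg; apply: (@leq_ltn_trans (C1 * P ^ 12)); last first.
    by rewrite [(P ^ 13)%N]expnS ltn_pmul2r // expn_gt0 P0.
  apply: (leq_trans hg).
  rewrite (_ : C1 * P ^ 12 = 2 * (Q * ((k0 * T).+1 * N)) ^ 2)%N.
    by rewrite leq_mul2l leq_exp2r.
  by rewrite /C1 (mulnA Q) [in RHS]expnMn /N -expnM mulnA.
have kap00 := ltW kap0.
case: o s1 s2 s3 => [k|] s1 s2 s3.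
  have [pos le2 lnle] := form_pos i j k iN jN.
  rewrite [aligned_value _ _ _ _ _ _]/=.
  set G := qform (1%R, be k, ga k) _ _ in pos le2 lnle *.
  set g := `|G|%N in le2 lnle *.
  have gE : g%:Z = G by rewrite /g abszE gtr0_norm.
  have Qg : (Q%:Z %| g%:Z - 1)%Z.
    rewrite gE (_ : G - 1 = ((m i)%:Z - 1) * ((m i)%:Z + 1)
       + (n0 * n' j)%N%:Z * (be k * (m i)%:Z + ga k * (n0 * n' j)%N%:Z)).
      by rewrite rpredD // dvdz_mulr // dvdzE /= dvdn_mulr.
    by rewrite /G /qform /=; ring.
  have [gq gw] := congr1_consequences (qQ j') hQw Qg.
  apply: (@near1_le _ (15 * kappa)); first by rewrite ler_wpM2r // ler_nat.
  apply: (@value_angle _ (q j') _ _ _ g (m i) (n0 * n' j)%N w P kappa) => //.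
  - by rewrite absz_gt0 gt_eqF.
  - by apply: gP.
  - apply: near1_expi; rewrite normrM.
    apply: (@le_trans _ _ (tt * (2 * (S.+1%:R * eta)))); first exact: ler_pM.
    by apply: (le_trans tSeta); rewrite ler_peMl // ler1n.
rewrite [aligned_value _ _ _ _ _ _]/=.
have -> : (B * (m i * (n0 * n' j)) = (B * n0) * (m i * n' j))%N.
  by rewrite (mulnCA (m i)) mulnA.
have mn0 : (0 < m i * n' j)%N by [].
have Bn00 : (0 < B * n0)%N by rewrite muln_gt0 B0.
rewrite (fM j' _ _ Bn00 mn0) -mulrA.
rewrite (_ : 16 * kappa = kappa + 15 * kappa); last by ring.
apply: near1M => //.
set g := (m i * n' j)%N.
have Qg : (Q%:Z %| g%:Z - 1)%Z.
  rewrite /g PoszM (_ : _ - 1 = ((m i)%:Z - 1) * (n' j)%:Z + ((n' j)%:Z - 1)).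
    by rewrite rpredD // dvdz_mulr.
  by ring.
have [gq gw] := congr1_consequences (qQ j') hQw Qg.
apply: (@value_angle _ (q j') _ _ _ g (m i) (n0 * n' j)%N w P kappa) => //.
- move=> p e pp wp; rewrite /qform /= mul0r add0r mul1r mul0r addr0 -PoszM.
  rewrite dvdzE /= mulnCA Gauss_dvdr // coprimeXl // prime_coprime //.
  exact: pn0.
- apply: gP; rewrite /g -mulnn; apply: (@leq_trans (m i * m i)).
    by rewrite leq_mul2l nm orbT.
  by rewrite leq_pmull.
- rewrite /g natrM lnM ?posrE ?ltr0n //.
  rewrite (_ : t j' * _ = t j' * - (ln (m i)%:R - ln (n' j)%:R - ln k0%:R)
      + - (t j' * ln k0%:R)); last by ring.
  rewrite expiD (_ : 2 * kappa = kappa + kappa); last by ring.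
  apply: near1M; last by rewrite expiN; apply: near1V.
  apply: near1_expi; rewrite normrM normrN; apply: le_trans hT.
  exact: ler_pM.
Qed.

End Aligned.

Section Solutions.
Variable R : realType.
Local Notation C := R[i].

Lemma circle_neq0 (f : nat -> C) : (forall n, (0 < n)%N -> unit_circle (f n)) ->
  forall n, (0 < n)%N -> f n != 0.
Proof. by move=> f1 n n0; rewrite -normr_gt0 (f1 n n0) ltr01. Qed.

(** The scales w and P are taken from the sequence N, which grows so fast that any
two of its members w < P are admissible; the pigeonhole principle then kills the
increments of all drifts at once. *)
Lemma aligned_values (s : nat) (f : 'I_s -> nat -> C) (K : finType)
    (be ga : K -> int) (B L : nat) (e : R) :
  (forall j n, (0 < n)%N -> unit_circle (f j n)) ->
  (forall j, completely_multiplicative (f j)) ->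
  (forall j, pretentious (f j)) ->
  (forall k, be k ^+ 2 - 4 * ga k != 0) -> (0 < B)%N -> 0 < e ->
  exists m n : nat, [/\ (0 < m)%N, (0 < n)%N, (L * n <= m)%N
    & forall k, 0 < qform (1%R, be k, ga k) m%:Z n%:Z /\
      forall j, near1 e (f j `|qform (1%R, be k, ga k) m%:Z n%:Z|%N
                         / f j (B * (m * n))%N)].
Proof.
move=> f1 fM fP D0 B0 e0.
have : forall j, exists d : nat * R * (nat -> R), pretentious_data (f j) d.1.1 d.1.2 d.2.
  move=> j; have [q [t [th h]]] := pretentious_structure (f1 j) (fM j) (fP j).
  by exists (q, t, th).
case/boolp.choice => d hd.
have k0 : 0 < e / 34 by rewrite divr_gt0.
have [w1 hw1] := progression_sampling L f1 fM hd D0 B0 k0.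
pose good w P := exists m n : nat, [/\ (0 < m)%N, (0 < n)%N, (L * n <= m)%N
    & forall o, (if o is Some k then 0 < qform (1%R, be k, ga k) m%:Z n%:Z else true)
      /\ forall j, near1 (16 * (e / 34)) (f j (aligned_value be ga B o m n)
        / (expi ((d j).1.2 * (2 * ln m%:R))
           * expi (drift (aligned_form be ga o) (d j).2 P
                   - drift (aligned_form be ga o) (d j).2 w)))].
have /boolp.choice[h hh] : forall w, exists P0, (w1 <= w)%N ->
    forall P, (P0 <= P)%N -> good w P.
  move=> w; have [ww|ww] := leqP w1 w; last by exists 0%N.
  by have [P0 hP0] := hw1 w ww; exists P0.
pose N i := iter i (fun w => maxn w (h w)) w1.
have NS i : (N i <= N i.+1)%N by rewrite /= leq_maxl.
have Nmono i j : (i <= j)%N -> (N i <= N j)%N.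
  move=> /subnKC <-; elim: (j - i)%N => [|k IH]; first by rewrite addn0.
  by rewrite addnS (leq_trans IH).
have Nw i : (w1 <= N i)%N by apply: (Nmono 0%N).
pose dr (o : option K) j w := drift (aligned_form be ga o) (d j).2 w.
have [i [i' [ii' hrec]]] := @torus_recurrence R ('I_s * option K)%type
  (fun i x => dr x.2 x.1 (N i)) _ k0.
have hN : (h (N i) <= N i')%N.
  by apply: (leq_trans _ (Nmono _ _ ii')); rewrite /= leq_maxr.
have [m [n [m0 n0 Lmn hmn]]] := hh _ (Nw i) _ hN.
exists m, n; split=> // k; have [pos hk] := hmn (Some k); split=> // j.
have [_ /(_ j) hr] := hmn None; have {}hk := hk j.
have r1 := hrec (j, Some k); have r2 := hrec (j, None).
rewrite /= in hk hr r1 r2.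
(* 16 for each of the two values compared, 1 for each of the two drifts *)
have eE : e = 16 * (e / 34) + 16 * (e / 34) + e / 34 + e / 34 by lra.
rewrite eE; clear eE.
move: hk hr r1 r2; rewrite /dr /=.
set V := f j _; set W := f j (B * _)%N.
set E0 := expi (_ * _); set E1 := expi _; set E2 := expi _.
move=> hk hr r1 r2.
have W0 : W != 0 by apply: (circle_neq0 (f1 j)); rewrite !muln_gt0 B0 m0.
have -> : V / W = V / (E0 * E1) * (W / (E0 * E2))^-1 * E1 * E2^-1.
  by field; rewrite W0 !expi_neq0.
apply: near1M; last exact: near1V.
by apply: near1M => //; apply: near1M => //; apply: near1V.
Qed.

(** * Solutions of the equation *)

Definition near_solutions (a b c s : nat) (f : 'I_s -> nat -> C) := forall e : R, 0 < e ->
  exists x y z : nat,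
    [/\ [/\ (0 < x)%N, (0 < y)%N & (0 < z)%N], [/\ x <> y, x <> z & y <> z],
      (a * x ^ 2 + b * y ^ 2 = c * z ^ 2)%N
    & forall j, near1 e (f j x / f j z) /\ near1 e (f j y / f j z)].

(** Multiplying a solution by a power of z that brings every f j (z ^ M) close
to 1. *)
Lemma scale_solution (a b c s : nat) (f : 'I_s -> nat -> C) (e : R) :
  (forall j n, (0 < n)%N -> unit_circle (f j n)) ->
  (forall j, completely_multiplicative (f j)) ->
  near_solutions a b c f -> 0 < e ->
  exists x y z : nat,
    [/\ (0 < x)%N, (0 < y)%N & (0 < z)%N] /\
    [/\ x <> y, x <> z & y <> z] /\
    (a * x ^ 2 + b * y ^ 2 = c * z ^ 2)%N /\
    forall j, [/\ near1 e (f j x), near1 e (f j y) & near1 e (f j z)].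
Proof.
move=> f1 fM sol e0; have e2 : 0 < e / 2 by rewrite divr_gt0.
have [x [y [z [[x0 y0 z0] [xy xz yz] eq hf]]]] := sol _ e2.
have /boolp.choice[al hal] : forall j, exists u, f j z = expi u.
  by move=> j; have [u _ ->] := unit_expi (f1 j _ z0); exists u.
have [M M0 hM] := simultaneous_recurrence al e2.
have k0 : (0 < z ^ M.-1)%N by rewrite expn_gt0 z0.
have fX j k : f j (z ^ k)%N = f j z ^+ k.
  elim: k => [|k IH].
    rewrite expn0 expr0; apply: (mulIf (circle_neq0 (f1 j) (n := 1) isT)).
    by rewrite mul1r -fM // mul1n.
  by rewrite expnS exprS fM ?expn_gt0 ?z0 // IH.
have fz j v : (0 < v)%N -> f j (z ^ M.-1 * v)%N = f j z ^+ M * (f j v / f j z).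
  move=> v0; rewrite fM // fX -{2}(prednK M0) exprS.
  have := circle_neq0 (f1 j) z0; move: (f j z ^+ M.-1) => X fz0.
  by rewrite [in RHS]mulrC mulrA divfK // mulrC.
have nz j : near1 (e / 2) (f j z ^+ M) by rewrite hal expiX.
have eE : e = e / 2 + e / 2 by lra.
exists (z ^ M.-1 * x)%N, (z ^ M.-1 * y)%N, (z ^ M.-1 * z)%N.
split; first by rewrite !muln_gt0 k0 x0 y0 z0.
have inj u v : u <> v -> (z ^ M.-1 * u)%N <> (z ^ M.-1 * v)%N.
  by move=> uv /eqP; rewrite eqn_pmul2l // => /eqP.
split; first by split; apply: inj.
split.
  rewrite !expnMn (mulnCA a) (mulnCA b) (mulnCA c) -mulnDr eq //.
move=> j; have [h1 h2] := hf j.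
rewrite !fz //; split; rewrite {1}eE.
- exact: near1M.
- exact: near1M.
- rewrite divff ?mulr1; last exact: (circle_neq0 (f1 j)).
  by apply: near1_le (nz j); lra.
Qed.

Lemma arc_near1 (I : set C) : open_arc I -> I 1 ->
  exists2 e : R, 0 < e & forall u, near1 e u -> I u.
Proof.
move=> [al [bt [ab ->]]] [th /andP[h1 h2] th1].
exists (Num.min (th - al) (bt - th) / 2).
  by rewrite divr_gt0 // lt_min !subr_gt0 h1.
move=> u [x]; rewrite ler_norml => /andP[x1 x2] ->.
have m1 : Num.min (th - al) (bt - th) <= th - al by rewrite ge_min lexx.
have m2 : Num.min (th - al) (bt - th) <= bt - th by rewrite ge_min lexx orbT.
exists (th + x); last by rewrite expiD th1 mul1r.
by apply/andP; split; lra.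
Qed.

Lemma nat_solution (a b c x y z : nat) (X Y Z : int) :
  x%:Z = X -> y%:Z = Y -> z%:Z = Z ->
  a%:Z * X ^+ 2 + b%:Z * Y ^+ 2 = c%:Z * Z ^+ 2 ->
  (a * x ^ 2 + b * y ^ 2 = c * z ^ 2)%N.
Proof.
move=> <- <- <- h; apply/eqP; rewrite -eqz_nat -!mulnn; apply/eqP.
by rewrite PoszD !PoszM -!expr2.
Qed.

(** The lower bound on m / n gives y < x, and x < z is clear. *)
Lemma solutions_eq_outer (a b s : nat) (f : 'I_s -> nat -> C) : (0 < a)%N -> (0 < b)%N ->
  (forall j n, (0 < n)%N -> unit_circle (f j n)) ->
  (forall j, completely_multiplicative (f j)) ->
  (forall j, pretentious (f j)) -> near_solutions a b a f.
Proof.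
move=> a0 b0 f1 fM fP e e0.
pose D := (a * b)%N; have D0 : (0 < D)%N by rewrite muln_gt0 a0.
pose ga (k : bool) : int := if k then D%:Z else - D%:Z.
have e2 : 0 < e / 2 by rewrite divr_gt0.
have dnz (k : bool) : (0 : int) ^+ 2 - 4 * ga k != 0.
  by rewrite expr0n sub0r oppr_eq0 mulf_neq0 //; case: k; rewrite /ga ?oppr_eq0 -lt0n.
have a20 : (0 < 2 * a)%N by rewrite muln_gt0.
have [m [n [m0 n0 Ln hmn]]] :=
  @aligned_values s f bool (fun=> 0) ga (2 * a) (2 * a + D + 1) _ f1 fM fP dnz a20 e2.
have [x0 hx] := hmn false; have [z0 hz] := hmn true.
set X := qform _ _ _ in x0 hx; set Z := qform _ _ _ in z0 hz.
pose y := (2 * a * (m * n))%N.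
have y0 : (0 < y)%N by rewrite !muln_gt0 a0 m0 n0.
have XE : X = m%:Z ^+ 2 - D%:Z * n%:Z ^+ 2 by rewrite /X /qform /=; ring.
have ZE : Z = m%:Z ^+ 2 + D%:Z * n%:Z ^+ 2 by rewrite /Z /qform /=; ring.
have xX : `|X|%N%:Z = X by rewrite abszE gtr0_norm.
have zZ : `|Z|%N%:Z = Z by rewrite abszE gtr0_norm.
have yY : y%:Z = 2 * a%:Z * (m%:Z * n%:Z) by rewrite /y !PoszM.
have xpos : (0 < `|X|)%N by rewrite absz_gt0 gt_eqF.
have zpos : (0 < `|Z|)%N by rewrite absz_gt0 gt_eqF.
have n0z : 0 < n%:Z by [].
have Ln' : (2 * a%:Z + D%:Z + 1) * n%:Z <= m%:Z by rewrite -lez_nat in Ln.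
have Dz : 0 < D%:Z by []. have az : 0 < a%:Z by [].
have nm : n%:Z <= m%:Z.
  by apply: le_trans Ln'; rewrite ler_peMl // ler_wpDl // addr_ge0.
have yx : y%:Z < X.
  rewrite yY XE.
  have h1 : (2 * a%:Z + D%:Z + 1) * n%:Z * m%:Z <= m%:Z * m%:Z by rewrite ler_wpM2r.
  have h2 : D%:Z * n%:Z * n%:Z <= D%:Z * n%:Z * m%:Z by rewrite ler_wpM2l ?mulr_ge0.
  have h3 : 0 < n%:Z * m%:Z by rewrite mulr_gt0.
  by move: h1 h2 h3; lra.
have xz : X < Z.
  have h3 : 0 < D%:Z * n%:Z ^+ 2 by rewrite mulr_gt0 // exprn_gt0.
  by rewrite XE ZE; move: h3; lra.
exists `|X|%N, y, `|Z|%N; split=> //.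
- split=> /(congr1 Posz).
  + by rewrite xX => h; move: yx; rewrite h ltxx.
  + by rewrite xX zZ => h; move: xz; rewrite h ltxx.
  + by rewrite zZ => h; move: (lt_trans yx xz); rewrite h ltxx.
- by apply: (nat_solution xX yY zZ); rewrite XE ZE /D PoszM; ring.
- move=> j; have fy := circle_neq0 (f1 j) y0; have fz := circle_neq0 (f1 j) zpos.
  split; last first.
    apply: (@near1_le _ (e / 2)); first by lra.
    by rewrite -[f j y / _]invrK invf_div; apply: near1V; apply: hz.
  rewrite (_ : e = e / 2 + e / 2); last by lra.
  rewrite (_ : _ / _ = (f j `|X|%N / f j y) * (f j `|Z|%N / f j y)^-1); last first.
    by field; rewrite fy fz.
  by apply: near1M; [apply: hx|apply: near1V; apply: hz].
Qed.

Lemma near_solutions_swap (a b c s : nat) (f : 'I_s -> nat -> C) :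
  near_solutions a b c f -> near_solutions b a c f.
Proof.
move=> sol e e0; have [x [y [z [[x0 y0 z0] [xy xz yz] eq hf]]]] := sol e e0.
exists y, x, z; split=> //; last by move=> j; have [] := hf j.
- by split=> // /esym.
- by rewrite addnC.
Qed.

(** The parametrization by lines through the point (1, 1, 1); here x < z < y, and
the form m n serves only as a common reference value. *)
Lemma solutions_eq_sum (a b s : nat) (f : 'I_s -> nat -> C) : (0 < a)%N -> (0 < b)%N ->
  (forall j n, (0 < n)%N -> unit_circle (f j n)) ->
  (forall j, completely_multiplicative (f j)) ->
  (forall j, pretentious (f j)) -> near_solutions a b (a + b) f.
Proof.
move=> a0 b0 f1 fM fP e e0.
pose c := (a + b)%N; pose D := (b * c)%N.
have c0 : (0 < c)%N by rewrite addn_gt0 a0.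
have D0 : (0 < D)%N by rewrite muln_gt0 b0.
pose be (k : option bool) : int :=
  match k with None => 0 | Some false => 2 * c%:Z | Some true => 2 * b%:Z end.
pose ga (k : option bool) : int := if k is None then - D%:Z else D%:Z.
have e2 : 0 < e / 2 by rewrite divr_gt0.
have az : 0 < a%:Z by []. have bz : 0 < b%:Z by [].
have cE : c%:Z = a%:Z + b%:Z by [].
have DE : D%:Z = b%:Z * c%:Z by rewrite /D PoszM.
have Dz : 0 < D%:Z by [].
have dnz k : be k ^+ 2 - 4 * ga k != 0.
  case: k => [[]|]; rewrite /be /ga ?DE ?cE.
  - rewrite (_ : _ - _ = - (4 * (a%:Z * b%:Z))); last by ring.
    by rewrite oppr_eq0 !mulf_neq0 // gt_eqF.
  - rewrite (_ : _ - _ = 4 * (a%:Z * (a%:Z + b%:Z))); last by ring.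
    by rewrite !mulf_neq0 // gt_eqF // addr_gt0.
  - rewrite (_ : _ - _ = 4 * (b%:Z * (a%:Z + b%:Z))); last by ring.
    by rewrite !mulf_neq0 // gt_eqF // addr_gt0.
have [m [n [m0 n0 _ hmn]]] :=
  @aligned_values s f _ be ga 1 1 _ f1 fM fP dnz isT e2.
have [x0 hx] := hmn None; have [y0 hy] := hmn (Some false).
have [z0 hz] := hmn (Some true).
set X := qform _ _ _ in x0 hx; set Y := qform _ _ _ in y0 hy.
set Z := qform _ _ _ in z0 hz.
have XE : X = m%:Z ^+ 2 - D%:Z * n%:Z ^+ 2 by rewrite /X /qform /=; ring.
have YE : Y = m%:Z ^+ 2 + 2 * c%:Z * m%:Z * n%:Z + D%:Z * n%:Z ^+ 2.
  by rewrite /Y /qform /=; ring.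
have ZE : Z = m%:Z ^+ 2 + 2 * b%:Z * m%:Z * n%:Z + D%:Z * n%:Z ^+ 2.
  by rewrite /Z /qform /=; ring.
have xX : `|X|%N%:Z = X by rewrite abszE gtr0_norm.
have yY : `|Y|%N%:Z = Y by rewrite abszE gtr0_norm.
have zZ : `|Z|%N%:Z = Z by rewrite abszE gtr0_norm.
have xpos : (0 < `|X|)%N by rewrite absz_gt0 gt_eqF.
have ypos : (0 < `|Y|)%N by rewrite absz_gt0 gt_eqF.
have zpos : (0 < `|Z|)%N by rewrite absz_gt0 gt_eqF.
have mz : 0 < m%:Z by []. have nz : 0 < n%:Z by [].
have h1 : 0 < D%:Z * n%:Z ^+ 2 by rewrite mulr_gt0 // exprn_gt0.
have h2 : 0 < b%:Z * m%:Z * n%:Z by rewrite !mulr_gt0.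
have h3 : 0 < a%:Z * m%:Z * n%:Z by rewrite !mulr_gt0.
have xz : X < Z by rewrite XE ZE; move: h1 h2; lra.
have zy : Z < Y by rewrite ZE YE cE; move: h3; lra.
exists `|X|%N, `|Y|%N, `|Z|%N; split=> //.
- split=> /(congr1 Posz); rewrite ?xX ?yY ?zZ => h.
  + by move: (lt_trans xz zy); rewrite h ltxx.
  + by move: xz; rewrite h ltxx.
  + by move: zy; rewrite h ltxx.
- by apply: (nat_solution xX yY zZ); rewrite XE YE ZE DE cE; ring.
- move=> j; have fr : f j (1 * (m * n))%N != 0.
    by apply: (circle_neq0 (f1 j)); rewrite !muln_gt0 m0.
  have fz := circle_neq0 (f1 j) zpos.
  rewrite (_ : e = e / 2 + e / 2); last by lra.
  set r := f j (1 * (m * n))%N in fr.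
  have quot u : u / f j `|Z|%N = (u / r) * (f j `|Z|%N / r)^-1.
    by field; rewrite fr fz.
  rewrite !quot.
  by split; apply: near1M; rewrite ?hx ?hy //; apply: near1V; apply: hz.
Qed.

End Solutions.

Local Open Scope classical_set_scope.

Theorem corollary1p2 (R : realType) (a b c : nat)
  (ha : (0 < a)%N) (hb : (0 < b)%N) (hc : (0 < c)%N)
  (habc : rado_triple a b c)
  (s : nat) (f : 'I_s -> nat -> R[i])
  (f_circle : forall (j : 'I_s) (n : nat), (0 < n)%N -> unit_circle (f j n))
  (f_mult : forall j : 'I_s, completely_multiplicative (f j))
  (f_pret : forall j : 'I_s, pretentious (f j))
  (I : set R[i]) (I_arc : open_arc I) (I1 : I 1) :
  exists x y z : nat,
    [/\ (0 < x)%N, (0 < y)%N & (0 < z)%N] /\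
    [/\ x <> y, x <> z & y <> z] /\
    (a * x ^ 2 + b * y ^ 2 = c * z ^ 2)%N /\
    forall j : 'I_s, [/\ I (f j x), I (f j y) & I (f j z)].
Proof.
have [e e0 heI] := arc_near1 I_arc I1.
have sol : near_solutions a b c f.
  case: habc => [<-|<-|<-]; first exact: solutions_eq_outer.
    by apply: near_solutions_swap; apply: solutions_eq_outer.
  exact: solutions_eq_sum.
have [x [y [z [xyz0 [xyz [eq hxyz]]]]]] := scale_solution f_circle f_mult sol e0.
exists x, y, z; do 3![split=> //]; move=> j.
by have [hx hy hz] := hxyz j; split; apply: heI.
Qed.
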